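(* Let $(V,\tau_V)$ be a nuclear space, $A$ an algebra generated by $V$, $J:=\{\langle W\rangle: W\text{ finite dimensional subspace of }V\}$, and $K\subseteq X(A)$ closed. Let $L:A\to\mathbb{R}$ be a linear functional with $L(1)=1$ and $L(a^2)\ge0$ for all $a\in A$, let $Q$ be a quadratic module in $A$ such that $K=K_Q$, and let $s_L(a):=\sqrt{L(a^2)}$ for $a\in A$. Suppose that for each $S\in J$ there exists a representing Radon measure $\nu_S$ for $L\restriction_S$ on $X(S)$ with support contained in $K_{Q\cap S}$, and that $s_L\restriction_V$ is $\tau_V$-continuous. Then for each Hilbertian seminorm $q$ on $V$ such that $M:=\{\alpha\in K_Q:\alpha\restriction_V\text{ is }q\text{-continuous}\}\neq\emptyset$ and $\mathrm{tr}(s_L\restriction_V/q)<\infty$, there exists a representing Radon measure $\nu$ for $L$ on $X(A)$ with $\nu(X(A)\setminus M)=0$.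
   Context: Algebras are unital commutative $\mathbb{R}$-algebras (not necessarily finitely generated). For an algebra $A$, the character space $X(A)$ is the set of all $\mathbb{R}$-algebra homomorphisms $A\to\mathbb{R}$; it is assumed non-empty and carries the weakest topology making all maps $\hat a:X(A)\to\mathbb{R}$, $\hat a(\alpha)=\alpha(a)$ ($a\in A$), continuous, and its Borel $\sigma$-algebra. $A$ is generated by a linear subspace $V$ if $V$ contains a set of generators of $A$; $\langle W\rangle$ is the subalgebra of $A$ generated by $W$. A Radon measure is a non-negative Borel measure that is locally finite and inner regular with respect to compact sets; its support is the smallest closed set with null complement. A representing Radon measure for a linear functional $L$ on $A$ is a Radon measure $\nu$ on $X(A)$ with $L(a)=\int_{X(A)}\hat a\,d\nu$ for all $a\in A$ (analogously for $S\in J$ and $X(S)$). A quadratic module in $A$ is a subset $Q\subseteq A$ with $1\in Q$, $Q+Q\subseteq Q$ and $a^2Q\subseteq Q$ for all $a\in A$; $K_Q:=\{\alpha\in X(A):\alpha(a)\ge0\ \forall a\in Q\}$. For a subalgebra $S$, $K_{Q\cap S}:=\{\alpha\in X(S):\alpha(a)\ge 0\ \forall a\in Q\cap S\}$. A seminorm $p$ on a real vector space is Hilbertian if $p(v)=\sqrt{\langle v,v\rangle_p}$ for a (necessarily unique) symmetric positive semidefinite bilinear form $\langle\cdot,\cdot\rangle_p$; $s_L$ is Hilbertian, induced by $(a,b)\mapsto L(ab)$. A linear functional $l$ on $V$ is $q$-continuous if $|l(v)|\le Cq(v)$ for all $v\in V$, for some $C>0$. For Hilbertian seminorms $p,q$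 on $V$, $\mathrm{tr}(p/q):=\sup_E\sum_{e\in E}p(e)^2$ over all finite $q$-orthonormal subsets $E\subseteq V$ if $\ker(q)\subseteq\ker(p)$, and $\mathrm{tr}(p/q):=\infty$ otherwise. A locally convex space $(V,\tau)$ is nuclear if $\tau$ is induced by a directed family $\mathcal{P}$ of Hilbertian seminorms on $V$ such that for each $p\in\mathcal{P}$ there exists $q\in\mathcal{P}$ with $\mathrm{tr}(p/q)<\infty$. *)

(* Defs.v *)
From HB Require Import structures.
From mathcomp Require Import all_boot all_order all_algebra finmap.
From mathcomp Require Import all_classical all_reals all_analysis.

Set Implicit Arguments.
Unset Strict Implicit.
Unset Printing Implicit Defensive.

Import Order.TTheory GRing.Theory Num.Theory.
Import numFieldNormedType.Exports.

Local Open Scope classical_set_scope.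
Local Open Scope ring_scope.

(* A commutative algebra with at least one character. Measurable types are    *)
(* pointed in MathComp-Analysis, so the standing assumption that X(A) is not  *)
(* empty is part of the structure.                                            *)
HB.mixin Record hasCharacter (R : realType) A of GRing.ComAlgebra R A := {
  character_neq0 : [set: {lrmorphism A -> R | *%R}] !=set0
}.

#[short(type="charAlgType")]
HB.structure Definition CharAlgebra (R : realType) :=
  {A of GRing.ComAlgebra R A & hasCharacter R A}.

Section CharacterSpace.
Context {R : realType}.

Definition charspace (A : charAlgType R) := {lrmorphism A -> R | *%R}.

Identity Coercion charspace_lrmorphism : charspace >-> GRing.LRMorphism.type.

HB.instance Definition _ (A : charAlgType R) := gen_eqMixin (charspace A).
HB.instance Definition _ (A : charAlgType R) := gen_choiceMixin (charspace A).
HB.instance Definition _ (A : charAlgType R) :=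
  isPointed.Build (charspace A) (sval (cid (@character_neq0 R A))).

Definition hat (A : charAlgType R) (a : A) (chi : charspace A) : R := chi a.

HB.instance Definition _ (A : charAlgType R) :=
  Topological.copy (charspace A)
    (sup_topology (fun a : A => Topological.class (initial_topology (hat a)))).

Definition nonneg_chars (A : charAlgType R) (Q : set A) : set (charspace A) :=
  [set chi | forall a, Q a -> 0 <= chi a].

Definition quadratic_module (A : charAlgType R) (Q : set A) : Prop :=
  [/\ Q 1, forall a b, Q a -> Q b -> Q (a + b)
    & forall a b, Q b -> Q (a ^+ 2 * b)].

Definition subalg_gen (A : charAlgType R) (G : set A) : set A :=
  smallest [set S : set A | GRing.subalg_closed [pred a | a \in S]] G.

End CharacterSpace.

Section Subalgebra.
Context {R : realType} {A : charAlgType R}.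

Definition subalg (S : subalgClosed A) := {a : A | a \in S}.

Variable S : subalgClosed A.

HB.instance Definition _ := SubChoice.on (subalg S).
HB.instance Definition _ := [SubChoice_isSubAlgebra of subalg S by <:].
HB.instance Definition _ := [SubNzRing_isSubComNzRing of subalg S by <:].

Section Restriction.
Variable chi : {lrmorphism A -> R | *%R}.

Definition char_restrict (a : subalg S) : R := chi (val a).

Let char_restrict_linear : scalable_for *%R char_restrict.
Proof. by move=> k a; rewrite /char_restrict !linearZ. Qed.

Let char_restrict_additive : {morph char_restrict : a b / a - b}.
Proof. by move=> a b; rewrite /char_restrict !rmorphB. Qed.

Let char_restrict_multiplicative : monoid_morphism char_restrict.
Proof.
by split=> [|a b]; rewrite /char_restrict ?rmorph1 ?rmorphM.
Qed.

HB.instance Definition _ :=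
  GRing.isZmodMorphism.Build (subalg S) R char_restrict char_restrict_additive.
HB.instance Definition _ := GRing.isMonoidMorphism.Build (subalg S) R
  char_restrict char_restrict_multiplicative.
HB.instance Definition _ := GRing.isScalable.Build R (subalg S) R *%R
  char_restrict char_restrict_linear.

Definition char_restrict_lrmorphism : {lrmorphism subalg S -> R | *%R} :=
  char_restrict.

End Restriction.

Let subalg_character_neq0 : [set: {lrmorphism subalg S -> R | *%R}] !=set0.
Proof.
by have [chi _] := @character_neq0 R A; exists (char_restrict_lrmorphism chi).
Qed.

HB.instance Definition _ :=
  hasCharacter.Build R (subalg S) subalg_character_neq0.

End Subalgebra.

Section RadonMeasure.
Context {R : realType}.

Definition borel (T : ptopologicalType) := g_sigma_algebraType (@open T).

HB.instance Definition _ (T : ptopologicalType) := Measurable.on (borel T).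

Definition locally_finite (T : ptopologicalType)
    (mu : {measure set (borel T) -> \bar R}) : Prop :=
  forall x : T, exists U : set T, [/\ open U, U x & (mu U < +oo)%E].

(* Compact sets are Borel when T is Hausdorff, in particular in charspace A;  *)
(* the measurability of C is only there so that mu C makes sense for all T.   *)
Definition inner_regular (T : ptopologicalType)
    (mu : {measure set (borel T) -> \bar R}) : Prop :=
  forall B : set (borel T), measurable B ->
    mu B = ereal_sup [set mu C | C in [set C : set (borel T) |
      [/\ compact (C : set T), measurable C & C `<=` B]]].

Definition radon (T : ptopologicalType)
    (mu : {measure set (borel T) -> \bar R}) : Prop :=
  locally_finite mu /\ inner_regular mu.

Definition support_of (T : ptopologicalType)
    (mu : {measure set (borel T) -> \bar R}) : set T :=
  \bigcap_(C in [set C : set T | closed C /\ mu (~` C) = 0%E]) C.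

Definition representing (A : charAlgType R) (L : A -> R)
    (nu : {measure set (borel (charspace A)) -> \bar R}) : Prop :=
  forall a : A, nu.-integrable [set: borel (charspace A)] (EFin \o hat a) /\
    (L a)%:E = (\int[nu]_chi (hat a chi)%:E)%E.

Definition representing_radon (A : charAlgType R) (L : A -> R)
    (nu : {measure set (borel (charspace A)) -> \bar R}) : Prop :=
  radon nu /\ representing L nu.

End RadonMeasure.

Section HilbertianSeminorm.
Context {R : realType}.

(* A Hilbertian seminorm is given by its form, which it determines by         *)
(* polarization.                                                              *)
Record hilbSeminorm (V : lmodType R) := HilbSeminorm {
  hform : {symmetric V};
  hform_ge0 : forall v, 0 <= hform v v
}.

Definition hnorm (V : lmodType R) (p : hilbSeminorm V) (v : V) : R :=
  Num.sqrt (hform p v v).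

Coercion hnorm : hilbSeminorm >-> Funclass.

Definition seminorm_ker (V : lmodType R) (p : V -> R) : set V :=
  [set v | p v = 0].

Definition hilb_orthonormal (V : lmodType R) (q : hilbSeminorm V)
    (E : {fset V}) : Prop :=
  {in E &, forall e f, hform q e f = (e == f)%:R}.

Definition hilb_trace (V : lmodType R) (p : V -> R) (q : hilbSeminorm V) : \bar R :=
  if `[< seminorm_ker q `<=` seminorm_ker p >] then
    ereal_sup [set (\sum_(e <- E) p e ^+ 2)%:E |
               E in [set E : {fset V} | hilb_orthonormal q E]]
  else +oo%E.

Definition seminorm_continuous (V : lmodType R) (q l : V -> R) : Prop :=
  exists2 C : R, 0 < C & forall v, `|l v| <= C * q v.

Definition directed_family (V : lmodType R) (P : set (hilbSeminorm V)) : Prop :=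
  P !=set0 /\ forall p1 p2, P p1 -> P p2 -> exists2 q, P q &
    exists2 C : R, 0 < C & forall v, Num.max (p1 v) (p2 v) <= C * q v.

Definition induced_by (V : tvsType R) (P : set (hilbSeminorm V)) : Prop :=
  forall (v : V) (U : set V), nbhs v U <->
    exists (n : nat) (p : 'I_n -> hilbSeminorm V) (eps : R),
      [/\ 0 < eps, forall i, P (p i) &
          [set w | forall i, p i (w - v) < eps] `<=` U].

Definition nuclear (V : tvsType R) : Prop :=
  exists P : set (hilbSeminorm V),
    [/\ directed_family P, induced_by P &
        forall p, P p -> exists2 q, P q & (hilb_trace p q < +oo)%E].

Definition finite_dim_subspace (V : lmodType R) (W : set V) : Prop :=
  exists (n : nat) (e : 'I_n -> V),
    W = [set v | exists c : 'I_n -> R, v = \sum_i c i *: e i].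

End HilbertianSeminorm.

Section GeneratedAlgebra.
Context {R : realType} {V : lmodType R} {A : charAlgType R}.

(* The subspace V of A is given with its own topology, hence as a separate    *)
(* type together with its inclusion iota into A.                              *)
Definition generated_by (iota : {linear V -> A}) : Prop :=
  exists2 G : set A, G `<=` range iota & subalg_gen G = setT.

Definition fin_gen_subalgs (iota : {linear V -> A}) : set (subalgClosed A) :=
  [set S | exists2 W : set V, finite_dim_subspace W &
             [set a | a \in S] = subalg_gen (iota @` W)].

Definition sL (L : A -> R) (a : A) : R := Num.sqrt (L (a ^+ 2)).

End GeneratedAlgebra.

(* Main.v *)
From HB Require Import structures.
Require Import Defs.
From mathcomp Require Import all_boot all_order all_algebra finmap.
From mathcomp Require Import all_classical all_reals all_analysis.
From mathcomp Require Import measurable_realfun lra.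

Set Implicit Arguments.
Unset Strict Implicit.
Unset Printing Implicit Defensive.

Import Order.TTheory GRing.Theory Num.Theory.
Import numFieldNormedType.Exports.

Local Open Scope classical_set_scope.
Local Open Scope ring_scope.

(** The functionals that [L] induces on the finitely generated subalgebras [S]
    of [A] have representing measures [nu_S], but these need not be compatible
    with each other, so there is no projective limit to take. A limit point of
    the [nu_S] is used instead, and it is the finiteness of the trace that
    keeps mass from escaping.

    Each character of [S], extended by zero, is a function on [A], so all
    [nu_S] live on the space [{ptws A -> R}]. If the vectors [e] of a finite
    [q]-orthonormal family lie in [S], the integral of the sum of the
    [chi e ^ 2] is the sum of the [L (e ^ 2)], at most the trace [tau]. By
    Markov and Cauchy-Schwarz, [nu_S] thus gives mass at least
    [1 - tau / n ^ 2] to the characters of [S] that are bounded by [n * q] on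
    a given finite part of [V] ([local_law]). Fix an ultrafilter on the finite
    parts of [V] that contains, for each of them, the set of all larger ones.
    Since [V] generates [A], limits along it of such functions are characters
    of [A] in [K_Q] bounded by [n * q] ([ultra_local_char]). Two things
    follow: the set of these characters is compact in [X(A)], and every
    neighbourhood of it eventually has mass at least [1 - tau / n ^ 2]
    ([bounded_chars_mass]).

    The limit measure is found directly on [X(A)] ([ultra_prokhorov]). The
    masses of open sets converge along the ultrafilter; the infimum of the
    limits over the open neighbourhoods of a compact set is a content, and a
    content on the compact sets of a Hausdorff space extends to a Radon
    measure [mu] ([radon_of_content]). By the previous paragraph [mu] has mass
    one and is carried by the union [M] of the compact sets of bounded
    characters.

    It remains to see that [mu] represents [L]. The portmanteau inequality on
    open sets shows that the integral of the square of [a] is at most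
    [L (a ^ 2)]; more cannot be expected from it, as moments may be lost in a
    limit. But applied to [a - c] for every real [c], this inequality already
    forces the integral of [a] to be [L a] ([mean_of_quadratic_bound]). *)

(** * Compact sets in Hausdorff spaces *)

(** Covering [C] with the sets [U] leaves finitely many [V], whose
    intersection is still in [G]. With [G] the neighbourhoods of a point this
    separates a point from a compact set; with [G] the neighbourhoods of a
    compact set, it separates two compact sets. *)
Lemma compact_separate_filter (T : topologicalType) (G : set_system T)
    (C : set T) : ProperFilter G -> compact C ->
    (forall x, C x -> exists U V,
       [/\ open U, U x, G V & U `&` V = set0]) ->
  exists U V, [/\ open U, C `<=` U, G V & U `&` V = set0].
Proof.
move=> FG /compact_near_coveringP cC sepC.
have PF : Filter (powerset_filter_from G) by exact: powerset_filter_from_filter.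
have := cC _ (powerset_filter_from G) (fun V x => (~` closure V) x) PF.
case=> [x /sepC[U [V [oU Ux GV UV0]]]|R [RG _ [V RV]] CV].
  exists (U, [set W | W `<=` V]) => /=.
    split; first exact: open_nbhs_nbhs.
    exact: small_set_sub.
  move=> [y W] /= [Uy WV] clWy.
  have [z [Wz Uz]] := clWy U (open_nbhs_nbhs (conj oU Uy)).
  by rewrite -[False]/(set0 z) -UV0; split=> //; exact: WV.
exists (~` closure V), V; split.
- exact/closed_openC/closed_closure.
- by move=> x Cx; exact: CV.
- exact: RG.
- by apply/disjoints_subset/subsetC/subset_closure.
Qed.

Lemma compact_disjoint_separate (T : topologicalType) (C D : set T) :
  hausdorff_space T -> compact C -> compact D -> C `&` D = set0 ->
  exists U V, [/\ open U, open V, C `<=` U, D `<=` V & U `&` V = set0].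
Proof.
move=> hT cC cD CD0.
have [->|/set0P D0] := eqVneq D set0.
  exists setT, set0; split => //; [exact: openT|exact: open0|by rewrite setI0].
have pD := set_nbhs_pfilter D0.
have [x Cx|U [V [oU CU DV UV]]] := compact_separate_filter pD cC.
- have [y Dy|V [U [oV DV xU VU]]] :=
      compact_separate_filter (nbhs_pfilter x) cD.
  + have xy : y != x.
      apply/eqP => yx; have : (C `&` D) x by split=> //; rewrite -yx.
      by rewrite CD0.
    move: hT; rewrite open_hausdorff => /(_ _ _ xy)[[A B]/=].
    rewrite !inE => -[Ay Bx] [oA oB AB]; exists A, B; split => //.
      exact: open_nbhs_nbhs.
  + exists (U^°), V; split.
    * exact: open_interior.
    * exact: xU.
    * by move=> y /DV Vy; exact: open_nbhs_nbhs.
    * apply/disjoints_subset => z /interior_subset Uz Vz.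
      by have : (V `&` U) z by []; rewrite VU.
- have /set_nbhsP[W [oW DW WV]] := DV.
  exists U, W; split => //.
  apply/disjoints_subset => z Uz /WV Vz.
  by have : (U `&` V) z by []; rewrite UV.
Qed.

(** Separate the disjoint compact sets [C `\` U] and [C `\` V] by open sets,
    and remove each of these from [C]. *)
Lemma compact_split (T : topologicalType) (C U V : set T) :
    hausdorff_space T -> compact C -> open U -> open V -> C `<=` U `|` V ->
  exists C1 C2, [/\ compact C1, compact C2, C1 `<=` U, C2 `<=` V
                  & C = C1 `|` C2].
Proof.
move=> hT cC oU oV CUV.
have compactD W : open W -> compact (C `\` W).
  move=> oW; apply: (subclosed_compact _ cC (@subIsetl _ _ _)).
  by apply: closedI; [exact: compact_closed|exact: open_closedC].
have UV0 : (C `\` U) `&` (C `\` V) = set0.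
  by rewrite -setDUr; apply/disjoints_subset; rewrite setCK.
have [A [B [oA oB UA VB AB0]]] :=
  compact_disjoint_separate hT (compactD _ oU) (compactD _ oV) UV0.
exists (C `\` A), (C `\` B); split; [exact: compactD|exact: compactD| | |].
- by move=> x [Cx nAx]; apply: contrapT => nUx; apply/nAx/UA.
- by move=> x [Cx nBx]; apply: contrapT => nVx; apply/nBx/VB.
- by rewrite -setDIr AB0 setD0.
Qed.

(** * Radon measures from contents on compact sets *)

(** A content in the sense of Halmos, normalized so that its values are
    finite. *)
Record compact_content (R : realType) (T : topologicalType)
    (lam : set T -> \bar R) : Prop := CompactContent {
  content_ge0 : forall C, (0 <= lam C)%E;
  content_le1 : forall C, compact C -> (lam C <= 1)%E;
  contentU_le : forall C D, compact C -> compact D ->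
    (lam (C `|` D) <= lam C + lam D)%E;
  le_contentU : forall C D, compact C -> compact D -> C `&` D = set0 ->
    (lam C + lam D <= lam (C `|` D))%E }.

Section content_extension.
Context {R : realType} {T : ptopologicalType}.
Variables (lam : set T -> \bar R) (hT : hausdorff_space T).
Hypothesis lamP : compact_content lam.
Local Open Scope ereal_scope.

Definition inner_content (U : set T) : \bar R :=
  ereal_sup [set lam C | C in [set C | compact C /\ C `<=` U]].

Definition outer_content (E : set T) : \bar R :=
  ereal_inf [set inner_content U | U in [set U | open U /\ E `<=` U]].

Lemma content_set0 : lam set0 = 0.
Proof.
have l0 := content_ge0 lamP set0; have l1 := content_le1 lamP (@compact0 T).
have := le_contentU lamP (@compact0 T) (@compact0 T) (setI0 _).
rewrite setU0; case: (lam set0) l0 l1 => [r| |]//=.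
by rewrite -EFinD !lee_fin gerDl => r0 _ rle0; congr EFin; apply/le_anti/andP.
Qed.

Lemma le_inner_content C U :
  compact C -> C `<=` U -> lam C <= inner_content U.
Proof. by move=> cC CU; apply: ereal_sup_ubound; exists C. Qed.

Lemma inner_content_ge0 U : 0 <= inner_content U.
Proof.
by rewrite -content_set0; apply: le_inner_content => //; exact: compact0.
Qed.

Lemma inner_content_le1 U : inner_content U <= 1.
Proof. by apply: ge_ereal_sup => _ [C [cC _] <-]; exact: content_le1. Qed.

Lemma inner_content_fin U : inner_content U \is a fin_num.
Proof.
rewrite ge0_fin_numE ?inner_content_ge0//.
by rewrite (le_lt_trans (inner_content_le1 U))// ltry.
Qed.

Lemma subset_inner_content U V :
  U `<=` V -> inner_content U <= inner_content V.
Proof.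
move=> UV; apply: ge_ereal_sup => _ [C [cC CU] <-].
by apply: le_inner_content => //; exact: subset_trans UV.
Qed.

Lemma inner_content0 : inner_content set0 = 0.
Proof.
apply/le_anti; rewrite inner_content_ge0 andbT.
apply: ge_ereal_sup => _ [C [cC +] <-].
by rewrite subset0 => ->; rewrite content_set0.
Qed.

(** A compact subset of [U `|` V] splits into compact subsets of [U] and
    [V]. *)
Lemma inner_contentU2 U V : open U -> open V ->
  inner_content (U `|` V) <= inner_content U + inner_content V.
Proof.
move=> oU oV; apply: ge_ereal_sup => _ [C [cC CUV] <-].
have [D [E [cD cE DU EV ->]]] := compact_split hT cC oU oV CUV.
by apply: le_trans (contentU_le lamP cD cE) _; apply: leeD;
  exact: le_inner_content.
Qed.

Lemma inner_content_bigcup (U : (set T)^nat) : (forall n, open (U n)) ->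
  inner_content (\bigcup_n U n) <= \sum_(n <oo) inner_content (U n).
Proof.
move=> oU; apply: ge_ereal_sup => _ [C [cC CU] <-].
have [N CN] : exists N, C `<=` \big[setU/set0]_(i < N) U i.
  move: cC; rewrite compact_cover => /(_ nat setT U (fun n _ => oU n) CU).
  move=> [D _ CD]; exists (\max_(i <- D) i).+1 => x /CD[i /= iD Uix].
  rewrite -bigcup_mkord; exists i => //=; rewrite ltnS.
  exact: leq_bigmax_seq.
apply: (@le_trans _ _ (inner_content (\big[setU/set0]_(i < N) U i))).
  exact: le_inner_content.
apply: (@le_trans _ _ (\sum_(0 <= i < N) inner_content (U i))); last first.
  by apply: nneseries_lim_ge => n _ _; exact: inner_content_ge0.
rewrite big_mkord; elim: N {CN} => [|N IH].
  by rewrite !big_ord0 inner_content0.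
rewrite !big_ord_recr/=; apply: le_trans (leeD2r _ IH).
by apply: inner_contentU2 => //; rewrite -bigcup_mkord; exact: bigcup_open.
Qed.

Lemma outer_contentE U : open U -> outer_content U = inner_content U.
Proof.
move=> oU; apply/le_anti/andP; split.
  by apply: ereal_inf_lbound; exists U => //; split.
by apply: le_ereal_inf_tmp => _ [V [oV UV] <-]; exact: subset_inner_content.
Qed.

Lemma outer_content_ge0 E : 0 <= outer_content E.
Proof. by apply: le_ereal_inf_tmp => _ [U _ <-]; exact: inner_content_ge0. Qed.

Lemma outer_content0 : outer_content set0 = 0.
Proof. by rewrite outer_contentE ?inner_content0//; exact: open0. Qed.

Lemma subset_outer_content :
  {homo outer_content : E F / E `<=` F >-> E <= F}.
Proof.
move=> E F EF; apply: ereal_inf_le_tmp => _ [U [oU FU] <-].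
by exists U => //; split => //; exact: subset_trans FU.
Qed.

Lemma outer_content_fin E : outer_content E \is a fin_num.
Proof.
rewrite ge0_fin_numE ?outer_content_ge0//.
apply: (@le_lt_trans _ _ (outer_content setT)).
  exact: subset_outer_content.
rewrite outer_contentE; last exact: openT.
by rewrite (le_lt_trans (inner_content_le1 _))// ltry.
Qed.

Lemma outer_content_adherent E (e : R) : (0 < e)%R ->
  exists U, [/\ open U, E `<=` U & inner_content U <= outer_content E + e%:E].
Proof.
move=> e0; have [_ [U [oU EU] <-] Ue] :=
  lb_ereal_inf_adherent e0 (outer_content_fin E).
by exists U; split => //; exact: ltW.
Qed.

Lemma outer_content_sigma_subadditive : sigma_subadditive outer_content.
Proof.
move=> F; apply/lee_addgt0Pr => e e0.
apply: le_trans (epsilon_trick xpredT _ (ltW e0)); last first.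
  by move=> n; exact: outer_content_ge0.
have /choice[U UP] : forall n, exists U, [/\ open U, F n `<=` U &
    inner_content U <= outer_content (F n) + (e / (2 ^ n.+1)%:R)%:E].
  by move=> n; apply: outer_content_adherent; rewrite divr_gt0// ltr0n expn_gt0.
apply: (@le_trans _ _ (inner_content (\bigcup_n U n))).
  apply: ereal_inf_lbound; exists (\bigcup_n U n) => //; split.
    by apply: bigcup_open => n _; have [] := UP n.
  by apply: subset_bigcup => n _; have [] := UP n.
apply: le_trans (inner_content_bigcup _) _; first by move=> n; have [] := UP n.
apply: lee_nneseries => n _; first by move=> _; exact: inner_content_ge0.
by have [] := UP n.
Qed.

HB.instance Definition _ := isOuterMeasure.Build R T outer_content
  outer_content0 outer_content_ge0 subset_outer_content
  outer_content_sigma_subadditive.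

(** Inside an open [V], exhaust [V `&` U] by a compact [C] and then [V `\` C],
    which contains [V `\` U], by a compact [D]: as [C] and [D] are disjoint,
    the content of their union is at least the sum of their contents. *)
Lemma open_caratheodory U : open U -> caratheodory_measurable outer_content U.
Proof.
move=> oU; apply: (@le_caratheodory_measurable _ _ outer_content) => X.
apply: le_ereal_inf_tmp => _ [V [oV XV] <-].
apply: (@le_trans _ _ (outer_content (V `&` U) + outer_content (V `&` ~` U))).
  by apply: leeD; apply: subset_outer_content; exact: setSI.
rewrite outer_contentE; last exact: openI.
rewrite -leeBrDr ?outer_content_fin//.
apply: ge_ereal_sup => _ [C [cC CVU] <-].
rewrite leeBrDr ?outer_content_fin//.
have oVC : open (V `&` ~` C).
  by apply: openI => //; apply: closed_openC; exact: compact_closed.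
apply: (@le_trans _ _ (lam C + inner_content (V `&` ~` C))).
  apply: leeD2l; rewrite -outer_contentE//; apply: subset_outer_content.
  by apply: setIS => x nUx /CVU[_].
rewrite addeC -leeBrDr; last first.
  rewrite ge0_fin_numE ?(content_ge0 lamP)//.
  by rewrite (le_lt_trans (content_le1 lamP cC))// ltry.
apply: ge_ereal_sup => _ [D [cD DVC] <-].
rewrite leeBrDr; last first.
  rewrite ge0_fin_numE ?(content_ge0 lamP)//.
  by rewrite (le_lt_trans (content_le1 lamP cC))// ltry.
apply: (le_trans (le_contentU lamP cD cC _)).
  by apply/disjoints_subset => x /DVC[].
apply: le_inner_content; first exact: compactU.
by move=> x [/DVC[]//|/CVU[]].
Qed.

Lemma borel_caratheodory (B : set (borel T)) :
  measurable B -> caratheodory_measurable outer_content B.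
Proof.
apply: smallest_sub; last by move=> U; exact: open_caratheodory.
exact: (@sigma_algebra_measurable _ (caratheodory_type outer_content)).
Qed.

(** The two proofs are arguments because the measure structure depends on
    them, and it is inferred from this term alone. *)
Definition content_measure of hausdorff_space T & compact_content lam :
  set (borel T) -> \bar R := outer_content.

Local Notation mu := (content_measure hT lamP).

Let content_measure_sigma_additive : semi_sigma_additive mu.
Proof.
move=> F mF tF mUF.
apply: (@caratheodory_measure_sigma_additive _ _ outer_content) => //.
- by move=> n; exact: borel_caratheodory.
- exact: borel_caratheodory.
Qed.

HB.instance Definition _ := isMeasure.Build _ (borel T) R mu
  outer_content0 outer_content_ge0 content_measure_sigma_additive.

Lemma outer_content_compact C : compact C -> lam C <= outer_content C.
Proof.
move=> cC; apply: le_ereal_inf_tmp => _ [U [_ CU] <-].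
exact: le_inner_content.
Qed.

(** Take [K] compact with small complement and [U] open around the complement
    of [B] with small excess: [K `\` U] is a compact subset of [B]. *)
Lemma content_measure_inner_regular : inner_regular mu.
Proof.
move=> B mB; rewrite /= /content_measure; apply/le_anti/andP; split; last first.
  by apply: ge_ereal_sup => _ [C [_ _ CB] <-]; exact: subset_outer_content.
apply/lee_addgt0Pr => e e0.
have e20 : (0 < e / 2)%R by rewrite divr_gt0.
have [_ [K [cK _] <-] Ke] :=
  ub_ereal_sup_adherent e20 (inner_content_fin setT).
have [U [oU BU Ue]] := outer_content_adherent (~` B) e20.
have clK : closed K by exact: compact_closed.
have cKU : compact (K `\` U).
  apply: (subclosed_compact _ cK (@subIsetl _ _ _)).
  by apply: closedI => //; exact: open_closedC.
have nK : outer_content (~` K) <= (e / 2)%:E.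
  have := open_caratheodory (closed_openC clK) setT.
  rewrite !setTI setCK outer_contentE; last exact: openT.
  move=> TK; move: Ke; rewrite -/(inner_content setT) TK => Ke.
  have := lt_le_trans Ke (outer_content_compact cK).
  rewrite lteBlDr// addeC lteD2lE ?outer_content_fin//.
  exact: ltW.
have UB : outer_content (U `&` B) <= (e / 2)%:E.
  have := borel_caratheodory mB U.
  rewrite (outer_contentE oU) => UE; move: Ue; rewrite UE.
  have -> : outer_content (U `&` ~` B) = outer_content (~` B).
    by rewrite setIidr.
  by rewrite addeC leeD2lE ?outer_content_fin.
apply: (@le_trans _ _ (outer_content ((K `\` U) `|` (~` K `|` U `&` B)))).
  apply: subset_outer_content => x Bx.
  have [Kx|] := pselect (K x); last by right; left.
  by have [Ux|] := pselect (U x); [right; right|left].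
apply: le_trans (outer_measureU2 outer_content _ _) _; apply: leeD.
  apply: ereal_sup_ubound; exists (K `\` U) => //; split => //.
    apply: measurableD.
      by rewrite -(setCK K); apply: measurableC; apply: sub_sigma_algebra;
        exact: closed_openC.
    exact: sub_sigma_algebra.
  by move=> x [_ nUx]; apply: contrapT => nBx; apply/nUx/BU.
apply: le_trans (outer_measureU2 outer_content _ _) _.
by rewrite (splitr e) EFinD; exact: leeD.
Qed.

Lemma content_measure_radon : radon mu.
Proof.
split; last exact: content_measure_inner_regular.
move=> x; exists setT; split => //; first exact: openT.
rewrite /= /content_measure -ge0_fin_numE; first exact: outer_content_fin.
exact: outer_content_ge0.
Qed.

End content_extension.

Theorem radon_of_content (R : realType) (T : ptopologicalType)
    (lam : set T -> \bar R) : hausdorff_space T -> compact_content lam ->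
  exists mu : {measure set (borel T) -> \bar R}, [/\ radon mu,
    forall U, open U -> mu U = inner_content lam U
    & forall C, compact C -> (lam C <= mu C)%E].
Proof.
move=> hT lamP; exists (content_measure hT lamP); split.
- exact: content_measure_radon.
- by move=> U; exact: outer_contentE.
- by move=> C; exact: outer_content_compact.
Qed.

(** * Limits of measures along an ultrafilter *)

Lemma ultra_fmap (I X : Type) (U : set_system I) (f : I -> X) :
  UltraFilter U -> UltraFilter (f @ U).
Proof.
move=> UU; split; first exact: fmap_proper_filter.
move=> G PG fUG; apply/seteqP; split => // B GB.
have [//|UnB] := in_ultra_setVsetC (f @^-1` B) UU.
have GnB : G (~` B) by exact: fUG.
by have := @filter_not_empty _ _ PG; rewrite -(setICr B); case; exact: filterI.
Qed.

Lemma ultra_bounded_cvg (R : realType) (I : Type) (U : set_system I)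
    (f : I -> R) (c : R) : UltraFilter U ->
  (\forall i \near U, `|f i| <= c) -> exists l : R, f @ U --> l.
Proof.
move=> UU fc; have := @segment_compact R (- c) c.
rewrite compact_ultra => /(_ (f @ U) (ultra_fmap f UU)) [].
  by near=> i; rewrite /= in_itv/= -ler_norml; near: i.
by move=> l [_ fl]; exists l.
Unshelve. all: by end_near. Qed.

Lemma le_filter_lim (R : realType) (I : Type) (F : set_system I)
    (f g : I -> R) (l m : R) : ProperFilter F ->
  f @ F --> l -> g @ F --> m -> (\forall i \near F, f i <= g i) -> l <= m.
Proof.
move=> PF fl gm fg; rewrite -subr_ge0.
suff : [set x : R | 0 <= x] (m - l) by [].
apply: (closed_cvg _ (@closed_ge R 0) _ _ (cvgB gm fl)).
by near=> i; rewrite /= -[X in 0 <= X]/(g i - f i) subr_ge0; near: i.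
Unshelve. all: by end_near. Qed.

Lemma eq_filter_lim (R : realType) (I : Type) (F : set_system I)
    (f g : I -> R) (l m : R) : ProperFilter F ->
  f @ F --> l -> g @ F --> m -> (\forall i \near F, f i = g i) -> l = m.
Proof.
move=> PF fl gm fg; apply/le_anti/andP; split.
  by apply: (le_filter_lim _ fl gm); near=> i; rewrite (near fg i).
by apply: (le_filter_lim _ gm fl); near=> i; rewrite (near fg i).
Unshelve. all: by end_near. Qed.

Lemma injective_hausdorff (T Y : topologicalType) (j : T -> Y) :
  continuous j -> injective j -> hausdorff_space Y -> hausdorff_space T.
Proof.
move=> jc jinj hY x y xy; apply/jinj/hY => A B Ax By.
by have [z [Az Bz]] := xy _ _ (jc x _ Ax) (jc y _ By); exists (j z).
Qed.

Section ultra_limit.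
Context {R : realType} {T Y : ptopologicalType} (j : T -> Y).
Hypotheses (hY : hausdorff_space Y) (jc : continuous j) (jinj : injective j).
Context {I : Type} (U : set_system I).
Hypothesis UU : UltraFilter U.
Variable P : I -> {measure set (borel Y) -> \bar R}.
Hypothesis P1 : forall i, P i setT = 1%E.

Let mopen (B : set Y) : open B -> measurable (B : set (borel Y)).
Proof. exact: sub_sigma_algebra. Qed.

Let P_le1 i (B : set Y) : open B -> (P i B <= 1)%E.
Proof.
move=> oB; rewrite -(P1 i).
by apply: le_measure; rewrite ?inE//; exact: mopen.
Qed.

Let P_fineK i (B : set Y) : open B -> ((fine (P i B))%:E = P i B)%E.
Proof.
move=> oB; rewrite fineK// ge0_fin_numE ?measure_ge0//.
by rewrite (le_lt_trans (P_le1 i oB))// ltry.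
Qed.

Definition ultra_mass (B : set Y) : R := lim (fine (P i B) @[i --> U]).

Lemma cvg_ultra_mass B :
  open B -> fine (P i B) @[i --> U] --> ultra_mass B.
Proof.
move=> oB.
have [|l fl] := @ultra_bounded_cvg R I U (fun i => fine (P i B)) 1 UU.
  near=> i; rewrite ger0_norm ?fine_ge0//.
  by rewrite -lee_fin P_fineK// P_le1.
by rewrite /ultra_mass; apply/cvg_ex; exists l.
Unshelve. all: by end_near. Qed.

Lemma ultra_mass_ge0 B : open B -> 0 <= ultra_mass B.
Proof.
move=> oB; apply: (le_filter_lim (f := fun=> 0) _ _ (cvg_ultra_mass oB)).
  exact: (cvg_cst 0).
by near=> i; exact: fine_ge0.
Unshelve. all: by end_near. Qed.

Lemma ultra_mass_le B c :
  open B -> (\forall i \near U, P i B <= c%:E)%E -> ultra_mass B <= c.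
Proof.
move=> oB Oc; apply: (le_filter_lim (g := fun=> c) _ (cvg_ultra_mass oB)).
  exact: (cvg_cst c).
by near=> i; rewrite -lee_fin P_fineK//; near: i.
Unshelve. all: by end_near. Qed.

Lemma le_ultra_mass B c :
  open B -> (\forall i \near U, c%:E <= P i B)%E -> c <= ultra_mass B.
Proof.
move=> oB Oc; apply: (le_filter_lim (f := fun=> c) _ _ (cvg_ultra_mass oB)).
  exact: (cvg_cst c).
by near=> i; rewrite -lee_fin P_fineK//; near: i.
Unshelve. all: by end_near. Qed.

Lemma subset_ultra_mass B B' :
  open B -> open B' -> B `<=` B' -> ultra_mass B <= ultra_mass B'.
Proof.
move=> oB oB' OO'.
apply: (le_filter_lim _ (cvg_ultra_mass oB) (cvg_ultra_mass oB')).
near=> i; rewrite -lee_fin !P_fineK//.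
by apply: le_measure; rewrite ?inE//; exact: mopen.
Unshelve. all: by end_near. Qed.

Lemma ultra_massU_le B B' : open B -> open B' ->
  ultra_mass (B `|` B') <= ultra_mass B + ultra_mass B'.
Proof.
move=> oB oB'; have oU : open (B `|` B') by exact: openU.
apply: (le_filter_lim _ (cvg_ultra_mass oU)
  (cvgD (cvg_ultra_mass oB) (cvg_ultra_mass oB'))).
near=> i; rewrite -lee_fin EFinD !P_fineK//.
by apply: measureU2; exact: mopen.
Unshelve. all: by end_near. Qed.

Lemma le_ultra_massU B B' : open B -> open B' -> B `&` B' = set0 ->
  ultra_mass B + ultra_mass B' <= ultra_mass (B `|` B').
Proof.
move=> oB oB' OO'0; have oU : open (B `|` B') by exact: openU.
apply: (le_filter_lim _ (cvgD (cvg_ultra_mass oB) (cvg_ultra_mass oB'))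
  (cvg_ultra_mass oU)).
near=> i; rewrite -lee_fin EFinD !P_fineK//.
by rewrite measureU//; exact: mopen.
Unshelve. all: by end_near. Qed.

(** The infimum over open neighbourhoods catches the mass that the [P i] put
    near [j @` C] without charging it. *)
Definition ultra_content (C : set T) : \bar R :=
  ereal_inf [set (ultra_mass B)%:E | B in [set B | open B /\ j @` C `<=` B]].

(** Disjoint compact sets have disjoint neighbourhoods, so the finite
    additivity of the limit on open sets passes to the content. *)
Lemma ultra_contentP : compact_content ultra_content.
Proof.
have lb C : (0 <= ultra_content C)%E.
  apply: le_ereal_inf_tmp => _ [B [oB _] <-].
  by rewrite lee_fin; exact: ultra_mass_ge0.
have ub C : (ultra_content C <= 1)%E.
  apply: ge_ereal_inf; exists (ultra_mass setT)%:E.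
    by exists setT => //; split => //; exact: openT.
  rewrite lee_fin; apply: ultra_mass_le; first exact: openT.
  by near=> i; rewrite P1.
have fin C : ultra_content C \is a fin_num.
  by rewrite ge0_fin_numE// (le_lt_trans (ub C))// ltry.
have adh C (e : R) : 0 < e -> exists B, [/\ open B, j @` C `<=` B &
    ((ultra_mass B)%:E <= ultra_content C + e%:E)%E].
  move=> e0; have [_ [B [oB CO] <-] Oe] := lb_ereal_inf_adherent e0 (fin C).
  by exists B; split => //; exact: ltW.
split => //.
- move=> C D _ _; apply/lee_addgt0Pr => e e0.
  have e20 : 0 < e / 2 by rewrite divr_gt0.
  have [B [oB CO Oe]] := adh C _ e20.
  have [B' [oB' DO' Oe']] := adh D _ e20.
  apply: (@le_trans _ _ (ultra_mass (B `|` B'))%:E).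
    apply: ereal_inf_lbound; exists (B `|` B') => //; split; first exact: openU.
    by rewrite image_setU; exact: setUSS.
  apply: (@le_trans _ _ (ultra_mass B + ultra_mass B')%:E).
    by rewrite lee_fin; exact: ultra_massU_le.
  rewrite EFinD (splitr e) [in leRHS]EFinD addeACA; exact: leeD.
- move=> C D cC cD CD0; apply: le_ereal_inf_tmp => _ [B [oB CDO] <-].
  have [V [W [oV oW CV DW VW]]] : exists V W, [/\ open V, open W,
      j @` C `<=` V, j @` D `<=` W & V `&` W = set0].
    apply: compact_disjoint_separate => //.
    + by apply: continuous_compact => //; exact: continuous_subspaceT.
    + by apply: continuous_compact => //; exact: continuous_subspaceT.
    + apply/disjoints_subset => _ [x Cx <-] [y Dy /jinj yx].
      by rewrite -[False]/(set0 x) -CD0; split => //; rewrite -yx.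
  have oOV : open (B `&` V) by exact: openI.
  have oOW : open (B `&` W) by exact: openI.
  apply: (@le_trans _ _ (ultra_mass (B `&` V) + ultra_mass (B `&` W))%:E).
    rewrite EFinD; apply: leeD; apply: ereal_inf_lbound.
    + exists (B `&` V) => //; split => // _ [x Cx <-]; split.
        by apply: CDO; exists x => //; left.
      by apply: CV; exists x.
    + exists (B `&` W) => //; split => // _ [x Dx <-]; split.
        by apply: CDO; exists x => //; right.
      by apply: DW; exists x.
  rewrite lee_fin.
  apply: (@le_trans _ _ (ultra_mass ((B `&` V) `|` (B `&` W)))).
    by apply: le_ultra_massU => //; rewrite setIACA VW setI0.
  apply: subset_ultra_mass => //; first exact: openU.
  by move=> x [[]|[]].
Unshelve. all: by end_near. Qed.

(** A limit point of the [P i] that lives on [T]. The first inequality is the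
    portmanteau bound on open sets. The second one reads the mass of a compact
    set off the masses of its open neighbourhoods in [Y]; it is how the
    tightness of a family [P i] prevents a loss of mass. *)
Theorem ultra_prokhorov :
  exists mu : {measure set (borel T) -> \bar R}, [/\ radon mu,
    forall B c, open B -> (\forall i \near U, P i B <= c%:E)%E ->
      (mu (j @^-1` B) <= c%:E)%E
    & forall C c, compact C ->
        (forall B, open B -> j @` C `<=` B ->
           \forall i \near U, c%:E <= P i B)%E ->
      (c%:E <= mu C)%E].
Proof.
have hT : hausdorff_space T by exact: injective_hausdorff jc jinj hY.
have [mu [rmu muO muC]] := radon_of_content hT ultra_contentP.
exists mu; split => // [B c oB Oc|C c cC Cc].
  rewrite muO; last by apply: open_comp => // x _; exact: jc.
  apply: ge_ereal_sup => _ [C [cC CO] <-].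
  apply: (@le_trans _ _ (ultra_mass B)%:E).
    apply: ereal_inf_lbound; exists B => //; split => // _ [x Cx <-].
    exact: CO.
  by rewrite lee_fin; exact: ultra_mass_le.
apply: le_trans (muC C cC).
apply: le_ereal_inf_tmp => _ [B [oB CO] <-].
by rewrite lee_fin; apply: le_ultra_mass => //; exact: Cc.
Qed.

End ultra_limit.

(** * Pointwise convergence and characters *)

HB.instance Definition _ (R : realType) (I : Type) :=
  isPointed.Build {ptws I -> R} (fun=> 0).

Lemma cvg_ptws (R : realType) (I : Type) (F : set_system {ptws I -> R})
    (g : {ptws I -> R}) :
  Filter F -> (forall a, f a @[f --> F] --> g a) -> F --> g.
Proof.
move=> FF Fg; apply/cvg_sup => a B.
rewrite (@nbhsE (initial_topology (@^~ a))) => -[_ [[C oC <-] Cg] CB].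
by apply: filterS CB _; apply: Fg; exact: open_nbhs_nbhs.
Qed.

Lemma eval_ptws_continuous (R : realType) (I : Type) (a : I) :
  continuous (fun f : {ptws I -> R} => f a).
Proof.
move=> f D /(@initial_continuous _ _ (fun f : {ptws I -> R} => f a)) nD.
have /cvg_sup/(_ a) : nbhs f --> f by exact: cvg_id.
exact.
Qed.

Lemma hausdorff_ptws (R : realType) (I : Type) : hausdorff_space {ptws I -> R}.
Proof.
move=> f g fg; apply/funext => a; apply: Rhausdorff => B C fB gC.
have [h [Bh Ch]] :=
  fg _ _ (eval_ptws_continuous fB) (eval_ptws_continuous gC).
by exists (h a).
Qed.

Section character_topology.
Context {R : realType} {A : charAlgType R}.

Definition char_fun (chi : charspace A) : {ptws A -> R} := fun a => chi a.

Lemma char_fun_inj : injective char_fun.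
Proof.
move=> [f cf] [g cg] /= fg; have {}fg : f = g := fg.
move: cf cg; rewrite {}fg => -[[m1] [m2] [m3]] [[n1] [n2] [n3]].
by rewrite (Prop_irrelevance m1 n1) (Prop_irrelevance m2 n2)
  (Prop_irrelevance m3 n3).
Qed.

Lemma hat_continuous (a : A) : continuous (hat a : charspace A -> R).
Proof.
move=> chi B /(@initial_continuous _ _ (hat a)) nB.
have /cvg_sup/(_ a) : nbhs chi --> chi by exact: cvg_id.
exact.
Qed.

Lemma cvg_charspace (F : set_system (charspace A)) (chi : charspace A) :
  Filter F -> (forall a, hat a @ F --> chi a) -> F --> chi.
Proof.
move=> FF Fchi; apply/cvg_sup => a B.
rewrite (@nbhsE (initial_topology (hat a))) => -[_ [[C oC <-] Cchi] CB].
by apply: filterS CB _; apply: Fchi; exact: open_nbhs_nbhs.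
Qed.

Lemma char_fun_continuous : continuous char_fun.
Proof.
move=> chi; apply: cvg_ptws => [|a]; first exact/fmap_filter/(nbhs_filter chi).
exact: hat_continuous.
Qed.

Lemma exists_char (f : A -> R) : f 1 = 1 ->
  (forall k a b, f (k *: a + b) = k * f a + f b) ->
  (forall a b, f (a * b) = f a * f b) ->
  exists chi : charspace A, forall a, chi a = f a.
Proof.
move=> f1 fl fM.
have f0 : f 0 = 0.
  have := fl 1 0 0; rewrite scale1r addr0 mul1r => /esym/eqP.
  by rewrite addrC -subr_eq0 addrK => /eqP.
have fZ : scalable_for *%R f by move=> k a; rewrite -[k *: a]addr0 fl f0 addr0.
have fB : {morph f : a b / a - b}.
  by move=> a b; rewrite addrC -scaleN1r fl mulN1r addrC.
have fMM : monoid_morphism f by split.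
pose fA := GRing.isZmodMorphism.Build A R f fB.
pose fM' := GRing.isMonoidMorphism.Build A R f fMM.
pose fS := GRing.isScalable.Build R A R *%R f fZ.
pose chi : {lrmorphism A -> R | *%R} := HB.pack f fA fM' fS.
by exists chi.
Qed.

(** The elements of [A] on which the [f i] are eventually bounded form a
    subalgebra that contains [V], hence all of [A]; so the limits exist
    everywhere, and the algebraic identities pass to them. *)
Lemma ultra_char (V : lmodType R) (iota : {linear V -> A}) (I : Type)
    (U : set_system I) (f : I -> A -> R) : generated_by iota -> UltraFilter U ->
    (\forall i \near U, f i 1 = 1) ->
    (forall k a b, \forall i \near U, f i (k *: a + b) = k * f i a + f i b) ->
    (forall a b, \forall i \near U, f i (a * b) = f i a * f i b) ->
    (forall v, exists c, \forall i \near U, `|f i (iota v)| <= c) ->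
  exists chi : charspace A, forall a, f i a @[i --> U] --> chi a.
Proof.
move=> [D Diota DA] UU f1 fl fM fb.
pose S := [set a : A | exists c, \forall i \near U, `|f i a| <= c].
have ST : S = setT.
  apply/seteqP; split => // a _.
  have : subalg_gen D a by rewrite DA.
  apply: smallest_sub; last by move=> _ /Diota[v _ <-]; exact: fb.
  split => [|k x y|x y]; rewrite !inE /=.
  - by exists 1; near=> i; rewrite (near f1 i)// normr1.
  - move=> [c xc] [d yd]; exists (`|k| * c + d); near=> i.
    rewrite (near (fl k x y) i)// (le_trans (ler_normD _ _))// normrM lerD//.
      by rewrite ler_wpM2l//; near: i.
    by near: i.
  - move=> [c xc] [d yd]; exists (c * d); near=> i.
    rewrite (near (fM x y) i)// normrM ler_pM//; by near: i.
have /choice[l lP] : forall a, exists l : R, f i a @[i --> U] --> l.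
  move=> a; have [c ac] : S a by rewrite ST.
  exact: ultra_bounded_cvg ac.
have [|k a b|a b|chi chil] := @exists_char l.
- by apply: (eq_filter_lim (g := fun=> 1) _ (lP 1) _ f1); exact: cvg_cst.
- exact: (eq_filter_lim _ (lP _) (cvgD (cvgMr (lP a)) (lP b)) (fl k a b)).
- exact: (eq_filter_lim _ (lP _) (cvgM (lP a) (lP b)) (fM a b)).
by exists chi => a; rewrite chil; exact: lP.
Unshelve. all: by end_near. Qed.

End character_topology.

(** * Orthonormal families for a semidefinite form *)

Section hilbertian_seminorm.
Context {R : realType} {V : lmodType R} (q : hilbSeminorm V).
Implicit Types u v w : V.
Local Notation ip := (hform q).

Lemma hformC u v : ip u v = ip v u.
Proof. by rewrite hermC expr0 mul1r. Qed.

Lemma hformDl u v w : ip (u + v) w = ip u w + ip v w.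
Proof. exact: linearDl. Qed.

Lemma hformDr u v w : ip u (v + w) = ip u v + ip u w.
Proof. exact: linearDr. Qed.

Lemma hformZl k u v : ip (k *: u) v = k * ip u v.
Proof. exact: linearZl_LR. Qed.

Lemma hformZr k u v : ip u (k *: v) = k * ip u v.
Proof. by rewrite hformC hformZl hformC. Qed.

Lemma hformNl u v : ip (- u) v = - ip u v.
Proof. exact: linearNl. Qed.

Lemma hform_suml (I : Type) (r : seq I) (c : I -> R) (f : I -> V) v :
  ip (\sum_(i <- r) c i *: f i) v = \sum_(i <- r) c i * ip (f i) v.
Proof.
elim: r => [|i r IH]; first by rewrite !big_nil linear0l.
by rewrite !big_cons hformDl hformZl IH.
Qed.

Lemma hform_sumr (I : Type) (r : seq I) (c : I -> R) (f : I -> V) v :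
  ip v (\sum_(i <- r) c i *: f i) = \sum_(i <- r) c i * ip v (f i).
Proof. by rewrite hformC hform_suml; apply: eq_bigr => i _; rewrite hformC. Qed.

(** The form is nonnegative at [t *: u + v], where it is affine in [t]. *)
Lemma hform_null u v : ip u u = 0 -> ip u v = 0.
Proof.
move=> u0; apply: contrapT => /eqP uv0.
pose t := - (ip v v + 1) / (2 * ip u v).
have := hform_ge0 q (t *: u + v).
rewrite !hformDl !hformDr !hformZl !hformZr u0 (hformC v u).
have -> : t * ip u v = - (ip v v + 1) / 2.
  by rewrite /t invfM mulrA divfK.
have := hform_ge0 q v; lra.
Qed.

(** As the form is only semidefinite, each [v] in [F] is expanded up to a
    vector [z] of seminorm zero. *)
Lemma gram_schmidt (F : seq V) : exists E : {fset V}, [/\ hilb_orthonormal q E,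
    forall P : set V, P 0 -> (forall k u v, P u -> P v -> P (k *: u + v)) ->
      (forall v, v \in F -> P v) -> forall e, e \in E -> P e
    & forall v, v \in F -> exists c z,
        v = \sum_(e <- E) c e *: e + z /\ ip z z = 0].
Proof.
elim: F => [|v F [E [Eon Espan EF]]]; first by exists fset0; split.
pose r := v - \sum_(e <- E) ip v e *: e.
have rE e : e \in E -> ip r e = 0.
  move=> eE; rewrite hformDl hformNl hform_suml (big_fsetD1 e)//=.
  rewrite (Eon e e)// eqxx mulr1 big_seq big1 ?addr0 ?subrr// => f.
  rewrite !inE => /andP[fe fE].
  by rewrite (Eon f e)// (negbTE fe) mulr0.
have vE : v = \sum_(e <- E) ip v e *: e + r by rewrite /r addrC subrK.
have [r0|r0] := eqVneq (ip r r) 0.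
  exists E; split => //.
    move=> P P0 PD PF; apply: Espan => // u uF.
    by apply: PF; rewrite inE uF orbT.
  move=> u; rewrite inE => /predU1P[->|/EF//].
  by exists (fun e => ip v e), r.
have rpos : 0 < ip r r by rewrite lt0r r0 hform_ge0.
pose s := Num.sqrt (ip r r).
have s0 : s != 0 by rewrite sqrtr_eq0 -ltNge.
have s2 : s ^+ 2 = ip r r by rewrite sqr_sqrtr// ltW.
pose e0 := s^-1 *: r.
have e0E e : e \in E -> ip e0 e = 0 by move=> eE; rewrite hformZl rE// mulr0.
have e00 : ip e0 e0 = 1.
  by rewrite hformZl hformZr -s2 expr2 (mulrA _ s) mulVf// mul1r mulVf.
have e0nE : e0 \notin E.
  by apply/negP => /e0E; rewrite e00 => /eqP; rewrite oner_eq0.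
exists (e0 |` E)%fset; split.
- move=> e f; rewrite !inE => /predU1P[->|eE] /predU1P[->|fE].
  + by rewrite e00 eqxx.
  + by rewrite e0E//; case: eqP => // e0f; rewrite e0f fE in e0nE.
  + by rewrite hformC e0E//; case: eqP => // e0f; rewrite -e0f eE in e0nE.
  + exact: Eon.
- move=> P P0 PD PF.
  have PE e : e \in E -> P e.
    by apply: Espan => // u uF; apply: PF; rewrite inE uF orbT.
  have PZ k u : P u -> P (k *: u).
    by move=> Pu; rewrite -[k *: u]addr0; exact: PD.
  move=> e; rewrite !inE => /predU1P[->|/PE//].
  apply: (PZ); rewrite /r addrC -scaleN1r; apply: (PD); last first.
    by apply: PF; rewrite inE eqxx.
  rewrite big_seq; elim/big_ind: _ => // [x y Px Py|e' e'E].
    by rewrite -[x]scale1r; exact: PD.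
  by apply: PZ; exact: PE.
- move=> u; rewrite inE => /predU1P[->|uF].
    exists (fun e => if e == e0 then s else ip v e), 0.
    rewrite linear0l addr0; split => //.
    rewrite big_fsetU1//= eqxx scalerA mulfV// scale1r addrC.
    rewrite {1}vE; congr (_ + _); apply: eq_big_seq => e eE.
    by rewrite ifN//; apply: contraNneq e0nE => <-.
  have [c [z [uE z0]]] := EF _ uF.
  exists (fun e => if e == e0 then 0 else c e), z; split => //.
  rewrite big_fsetU1//= eqxx scale0r add0r {1}uE; congr (_ + _).
  apply: eq_big_seq => e eE.
  by rewrite ifN//; apply: contraNneq e0nE => <-.
Qed.

(** Cauchy-Schwarz: as [z] is orthogonal to everything, the vector on the
    right has the sum of the [c e ^ 2] as the square of its seminorm. *)
Lemma le_hnorm_orthonormal (E : {fset V}) (c l : V -> R) (z : V) (n : R) :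
  hilb_orthonormal q E -> ip z z = 0 -> 0 < n ->
  \sum_(e <- E) l e ^+ 2 <= n ^+ 2 ->
  `|\sum_(e <- E) c e * l e| <= n * q (\sum_(e <- E) c e *: e + z).
Proof.
move=> Eon z0 n0 ln.
have qE : ip (\sum_(e <- E) c e *: e + z) (\sum_(e <- E) c e *: e + z) =
    \sum_(e <- E) c e ^+ 2.
  rewrite hformDl [X in _ + X]hform_null// addr0 hformDr.
  rewrite [X in _ + X]hformC [X in _ + X]hform_null// addr0 hform_suml.
  apply: eq_big_seq => e eE; rewrite hform_sumr (big_fsetD1 e)//=.
  rewrite (Eon e e)// eqxx mulr1 big_seq big1 ?addr0 ?expr2// => f.
  rewrite !inE => /andP[fe fE].
  by rewrite (Eon e f)// eq_sym (negbTE fe) mulr0.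
rewrite /hnorm qE.
set S := \sum_(e <- E) c e * l e; set X := \sum_(e <- E) c e ^+ 2.
have n2 : n ^+ 2 != 0 by rewrite sqrf_eq0 gt_eqF.
(* The sum of the [(c e - t * l e) ^ 2] is nonnegative for every [t]; this value
   makes it the claim. *)
pose t := S / n ^+ 2.
have tX : 0 <= X - 2 * t * S + t ^+ 2 * \sum_(e <- E) l e ^+ 2.
  have -> : X - 2 * t * S + t ^+ 2 * \sum_(e <- E) l e ^+ 2 =
      \sum_(e <- E) (c e - t * l e) ^+ 2.
    rewrite !mulr_sumr -sumrB -big_split/=; apply: eq_bigr => e _.
    lra.
  by apply: sumr_ge0 => e _; exact: sqr_ge0.
have SX : S ^+ 2 <= n ^+ 2 * X.
  rewrite -ler_pdivrMl ?exprn_gt0//.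
  have tS : t * S = (n ^+ 2)^-1 * S ^+ 2 by rewrite /t expr2 mulrAC mulrC.
  have tn : t ^+ 2 * n ^+ 2 = t * S by rewrite expr2 -mulrA divfK.
  have := ler_wpM2l (sqr_ge0 t) ln; rewrite tn -tS.
  by move: tX; rewrite -mulrA; lra.
rewrite -[n]ger0_norm ?(ltW n0)// -[Num.sqrt X]ger0_norm ?sqrtr_ge0// -normrM.
rewrite -(@ler_pXn2r _ 2) ?nnegrE ?normr_ge0// !real_normK ?num_real//.
by rewrite exprMn sqr_sqrtr// sumr_ge0// => e _; exact: sqr_ge0.
Qed.

End hilbertian_seminorm.

(** * Representing measures *)

Lemma measurable_open (T : ptopologicalType) (U : set T) :
  open U -> measurable (U : set (borel T)).
Proof. exact: sub_sigma_algebra. Qed.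

Lemma measurable_closed (T : ptopologicalType) (C : set T) :
  closed C -> measurable (C : set (borel T)).
Proof.
move=> clC; rewrite -(setCK C); apply: measurableC; apply: measurable_open.
exact: closed_openC.
Qed.

Lemma closed_support (R : realType) (T : ptopologicalType)
    (mu : {measure set (borel T) -> \bar R}) : closed (support_of mu).
Proof. by apply: closed_bigI => C []. Qed.

(** By inner regularity it is enough to look at compact sets off the support;
    such a set is covered by finitely many open null sets. *)
Lemma radon_support_null (R : realType) (T : ptopologicalType)
    (mu : {measure set (borel T) -> \bar R}) :
  radon mu -> mu (~` support_of mu) = 0%E.
Proof.
move=> [_ rmu].
have oS : open (~` support_of mu) by apply: closed_openC; exact: closed_support.
rewrite rmu; last exact: measurable_open.
apply/le_anti/andP; split; last first.
  apply: ereal_sup_ubound; exists set0; last exact: measure0.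
  by split => //; exact: compact0.
apply: ge_ereal_sup => _ [C [cC mC CS] <-].
suff : mu.-negligible C by move/negligibleP => /(_ mC) ->.
pose D := [set U : set T | open U /\ mu U = 0%E].
move: cC; rewrite compact_cover => /(_ (set T) D id) [U [] //||D' D'D CD'].
  move=> x /CS; rewrite /support_of setC_bigcap => -[B [clB B0] nBx].
  by exists (~` B) => //; split => //; exact: closed_openC.
apply: (@negligibleS _ _ _ mu _ _ CD'); rewrite /cover bigcup_fset/=.
rewrite big_seq; elim/big_ind : _ => [||U /D'D].
- exact: negligible_set0.
- by move=> A B; exact: negligibleU.
- rewrite inE => -[oU U0]; apply/negligibleP => //; exact: measurable_open.
Qed.

Section representing_measure.
Context {R : realType} {B : charAlgType R}.
Variables (L : B -> R) (nu : {measure set (borel (charspace B)) -> \bar R}).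
Hypothesis nuL : representing L nu.

Lemma representing_total : nu setT = (L 1)%:E.
Proof.
have [_ ->] := nuL 1.
rewrite (eq_integral (cst 1%E)); last by move=> chi _; rewrite /hat rmorph1.
by rewrite integral_cst// mul1e.
Qed.

Lemma open_lt_hat (c : R) b : open [set chi : charspace B | c < chi b].
Proof.
apply: (@open_comp _ _ (hat b) [set x | c < x]); last exact: open_gt.
by move=> chi _; exact: hat_continuous.
Qed.

Lemma representing_markov (c : R) b : 0 < c ->
  (forall chi : charspace B, 0 <= chi b) ->
  (nu [set chi : charspace B | (c < chi b)%R] <= (L b / c)%:E)%E.
Proof.
move=> c0 b0; have [/integrableP[mb _] Lb] := nuL b.
have := @le_integral_abse _ _ _ nu setT measurableT _ c mb c0.
pose g : borel (charspace B) -> \bar R := EFin \o hat b.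
rewrite (eq_integral g); last first.
  by move=> chi _ /=; rewrite ger0_norm ?b0.
rewrite -Lb setTI => cL.
rewrite EFinM lee_pdivlMr// muleC; apply: le_trans cL.
apply: lee_wpmul2l; first by rewrite lee_fin ltW.
apply: le_measure; rewrite ?inE.
- by apply: measurable_open; exact: open_lt_hat.
- apply: measurable_closed.
  have -> : [set chi | (c%:E <= `|(EFin \o hat b) chi|)%E] =
      hat b @^-1` [set x | c <= x].
    by apply/seteqP; split => chi /=; rewrite lee_fin ger0_norm// b0.
  by apply: closed_comp; [move=> chi _; exact: hat_continuous|exact: closed_ge].
- by move=> chi /= cb; rewrite lee_fin ger0_norm ?b0// ltW.
Qed.

Lemma representing_null b : (forall chi : charspace B, 0 <= chi b) ->
  L b = 0 -> nu [set chi : charspace B | (0 < chi b)%R] = 0%E.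
Proof.
move=> b0 Lb0.
have -> : [set chi : charspace B | (0 < chi b)%R] =
    \bigcup_n [set chi : charspace B | (n.+1%:R^-1 < chi b)%R].
  apply/seteqP; split => [chi /= chib|chi [n _] /=]; last first.
    by apply: lt_trans; rewrite invr_gt0.
  have [n _ /(_ _ (leqnn n)) nb] := near_infty_natSinv_lt (PosNum chib).
  by exists n.
apply: measure_negligible.
  apply: bigcup_measurable => n _; apply: measurable_open.
  exact: open_lt_hat.
apply: negligible_bigcup => n; apply/negligibleP.
  by apply: measurable_open; exact: open_lt_hat.
apply/le_anti; rewrite measure_ge0 andbT.
have := @representing_markov n.+1%:R^-1 b _ b0.
by rewrite Lb0 mul0r; apply; rewrite invr_gt0.
Qed.

End representing_measure.

(** * Finitely generated subalgebras *)

Section finitely_generated.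
Context {R : realType} {A : charAlgType R} {V : lmodType R}.
Variable iota : {linear V -> A}.

Lemma subalg_gen_sub (G : set A) : G `<=` subalg_gen G.
Proof. exact: sub_gen_smallest. Qed.

Lemma subalg_gen_subalgClosed (G : set A) :
  exists S : subalgClosed A, [set a | a \in S] = subalg_gen G.
Proof.
have closedG : GRing.subalg_closed [pred a | a \in subalg_gen G].
  split => [|k x y|x y]; rewrite !inE.
  - by move=> S [[S1 _ _] _]; move: S1; rewrite !inE.
  - move=> xG yG S SP; have [[_ SD _] _] := SP.
    by have := SD k x y; rewrite !inE; apply; [exact: xG|exact: yG].
  - move=> xG yG S SP; have [[_ _ SM] _] := SP.
    by have := SM x y; rewrite !inE; apply; [exact: xG|exact: yG].
pose S : {pred A} := [pred a | a \in subalg_gen G].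
pose cS := GRing.isSubalgClosed.Build R A S closedG.
pose S' : subalgClosed A := HB.pack S cS.
exists S'; apply/seteqP; split => a /=.
  by rewrite -topredE /= inE.
by move=> aG; rewrite -topredE /= inE.
Qed.

Definition span_seq (F : seq V) : set V :=
  [set v | exists c : 'I_(size F) -> R, v = \sum_i c i *: F`_i].

Lemma mem_span_seq F v : v \in F -> span_seq F v.
Proof.
move=> vF; have iF : (index v F < size F)%N by rewrite index_mem.
exists (fun i => (i == Ordinal iF)%:R); rewrite (bigD1 (Ordinal iF))//= eqxx.
by rewrite scale1r nth_index// big1 ?addr0// => i /negbTE ->; rewrite scale0r.
Qed.

Lemma fin_gen_subalg (F : seq V) : exists2 S : subalgClosed A,
  fin_gen_subalgs iota S & forall v, v \in F -> iota v \in S.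
Proof.
have [S SE] := subalg_gen_subalgClosed (iota @` span_seq F).
exists S.
  by exists (span_seq F) => //; exists (size F), (fun i => F`_i).
move=> v vF; suff : [set a | a \in S] (iota v) by [].
by rewrite SE; apply: subalg_gen_sub; exists v => //; exact: mem_span_seq.
Qed.

End finitely_generated.

(** * Integrals and layer sums *)

Section layer_sum.
Context {R : realType} (d : measure_display) (T : measurableType d).
Variables (mu : {measure set T -> \bar R}) (g : T -> R) (dlt : R).
Hypotheses (mg : measurable_fun setT g) (g0 : forall x, 0 <= g x).
Hypothesis (d0 : 0 < dlt).

Definition layer (k : nat) : set T := [set x | k.+1%:R * dlt < g x].

(** A lower sum for the integral of [g] that only uses the values of [mu] on
    the sets where [g] exceeds a constant. These sets are open for a
    continuous [g], which is what makes the sum accessible to limits of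
    measures. *)
Definition layer_sum (N : nat) : \bar R :=
  (\sum_(0 <= k < N) dlt%:E * mu (layer k))%E.

Let step (k : nat) (x : T) : R := dlt * \1_(layer k) x.

Let stepE k x : step k x = if k.+1%:R * dlt < g x then dlt else 0.
Proof.
rewrite /step indicE.
have -> : (x \in layer k) = (k.+1%:R * dlt < g x) by apply/idP/idP; rewrite inE.
by case: ifP; rewrite (mulr0, mulr1).
Qed.

Let step_ge0 k x : 0 <= step k x.
Proof. by rewrite stepE; case: ifP => // _; exact: ltW. Qed.

Let step_sum_le N x : \sum_(0 <= k < N) step k x <= Num.min (g x) (N%:R * dlt).
Proof.
elim: N => [|N IH]; first by rewrite big_nil mul0r le_min g0 lexx.
rewrite big_nat_recr//= stepE -natr1 mulrDl mul1r.
move: IH; rewrite !le_min => /andP[IHg IHN]; have := d0.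
by case: ifPn; rewrite -?leNgt => gN d_gt0; apply/andP; split; lra.
Qed.

Let le_step_sum N x :
  Num.min (g x) (N.+1%:R * dlt) <= dlt + \sum_(0 <= k < N) step k x.
Proof.
elim: N => [|N]; first by rewrite big_nil addr0 mul1r ge_min lexx orbT.
rewrite big_nat_recr//= stepE -[N.+2%:R]natr1 mulrDl mul1r.
set S := \sum_(0 <= k < N) _; have := d0.
case: (ltP (N.+1%:R * dlt) (g x)) => gN d_gt0 IH; rewrite ge_min.
  by apply/orP; right; lra.
by apply/orP; left; lra.
Qed.

Let mlayer k : measurable (layer k).
Proof.
rewrite (_ : layer k = setT `&` g @^-1` `]k.+1%:R * dlt, +oo[).
  exact: mg.
by rewrite setTI; apply/seteqP; split => x /=; rewrite in_itv/= andbT.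
Qed.

Let mstep k : measurable_fun setT (fun x => (step k x)%:E).
Proof.
apply/measurable_EFinP; apply: measurable_funM => //; exact: measurable_indic.
Qed.

Let integral_step k : (\int[mu]_x (step k x)%:E = dlt%:E * mu (layer k))%E.
Proof.
under eq_integral do rewrite EFinM.
rewrite ge0_integralZl_EFin//; last 2 first.
- by apply/measurable_EFinP; exact: measurable_indic.
- exact: ltW.
by rewrite integral_indic// setIT.
Qed.

Lemma layer_sum_le N : (layer_sum N <= \int[mu]_x (g x)%:E)%E.
Proof.
rewrite /layer_sum; under eq_bigr do rewrite -integral_step.
rewrite -ge0_integral_sum//; last by move=> k x _; rewrite lee_fin.
apply: ge0_le_integral => //.
- by move=> x _; apply: sume_ge0 => k _; rewrite lee_fin.
- by apply: emeasurable_sum.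
- exact/measurable_EFinP.
- move=> x _; rewrite sumEFin lee_fin.
  by have := step_sum_le N x; rewrite le_min => /andP[].
Qed.

Lemma le_layer_sum (c : \bar R) : (forall N, layer_sum N <= c)%E ->
  (\int[mu]_x (g x)%:E <= dlt%:E * mu setT + c)%E.
Proof.
move=> cN.
apply: (@le_trans _ _
    (\int[mu]_x (dlt%:E + \sum_(0 <= k <oo) (step k x)%:E))%E).
  apply: ge0_le_integral => //.
  - by move=> x _; rewrite lee_fin.
  - exact/measurable_EFinP.
  - apply: emeasurable_funD => //.
    by apply: ge0_emeasurable_sum => // k x _ _; rewrite lee_fin.
  - move=> x _.
    have [N gN] : exists N : nat, g x <= N.+1%:R * dlt.
      exists (Num.truncn (g x / dlt)); rewrite -ler_pdivrMr//.
      exact/ltW/truncnS_gt.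
    apply: (@le_trans _ _ (dlt%:E + \sum_(0 <= k < N) (step k x)%:E)%E).
      rewrite sumEFin -EFinD lee_fin.
      by have := le_step_sum N x; rewrite min_l.
    apply: leeD2l; apply: nneseries_lim_ge => k _ _.
    by rewrite lee_fin.
rewrite ge0_integralD//; last 3 first.
- by move=> x _; rewrite lee_fin ltW.
- by move=> x _; apply: nneseries_ge0 => k _ _; rewrite lee_fin.
- by apply: ge0_emeasurable_sum => // k x _ _; rewrite lee_fin.
rewrite integral_cst//; apply: leeD2l.
rewrite integral_nneseries//; last by move=> k x _; rewrite lee_fin.
apply: lime_le.
  apply: is_cvg_nneseries => k _ _.
  by apply: integral_ge0 => x _; rewrite lee_fin.
apply: nearW => N; apply: le_trans (cN N).
by rewrite /layer_sum; apply: lee_sum => k _; rewrite integral_step.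
Qed.

End layer_sum.

(** A layer sum involves finitely many open sets, and for each of these the
    portmanteau bound says that eventually [P i] has almost as much mass as
    [mu]. *)
Lemma layer_sum_ultra (R : realType) (T Y : ptopologicalType) (j : T -> Y)
    (I : Type) (U : set_system I) (P : I -> {measure set (borel Y) -> \bar R})
    (mu : {measure set (borel T) -> \bar R})
    (g : Y -> R) (dlt c : R) (N : nat) :
    UltraFilter U -> mu setT = 1%E -> 0 < dlt -> continuous g -> continuous j ->
    (forall (B : set Y) b, open B -> (\forall i \near U, P i B <= b%:E)%E ->
      (mu (j @^-1` B) <= b%:E)%E) ->
    (\forall i \near U, layer_sum (P i) g dlt N <= c%:E)%E ->
  (layer_sum mu (g \o j) dlt N <= c%:E)%E.
Proof.
move=> UU mu1 dlt0 cg cj muP Pc.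
pose B k : set Y := [set y | k.+1%:R * dlt < g y].
have oB k : open (B k).
  by apply: (@open_comp _ _ g [set x | k.+1%:R * dlt < x]);
    [move=> x _; exact: cg|exact: open_gt].
pose x k := fine (mu (j @^-1` B k)).
have xE k : mu (j @^-1` B k) = (x k)%:E.
  rewrite /x fineK// ge0_fin_numE//.
  apply: (@le_lt_trans _ _ 1%E); last exact: ltry.
  rewrite -mu1; apply: le_measure; rewrite ?inE//.
  by apply: measurable_open; apply: open_comp => // t _; exact: cj.
apply/lee_addgt0Pr => e e0.
(* Each of the [N] layers may lose [dlt * eta], less than [e] altogether. *)
pose eta := e / (N.+1%:R * dlt).
have Ndlt0 : 0 < N.+1%:R * dlt by rewrite mulr_gt0.
have eta0 : 0 < eta by rewrite divr_gt0.
have near_x k : \forall i \near U, ((x k - eta)%:E <= P i (B k))%E.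
  have [/(muP _ _ (oB k))|Un] := in_ultra_setVsetC
      [set i | (P i (B k) <= (x k - eta)%:E)%E] UU.
    by rewrite xE lee_fin; have := eta0; lra.
  by apply: filterS Un => i /= /negP; rewrite -ltNge => /ltW.
have near_all : \forall i \near U, forall k : 'I_N,
    ((x k - eta)%:E <= P i (B k))%E.
  by apply: filter_forall => k; exact: near_x.
have [i [Pi xi]] := filter_ex (filterI Pc near_all).
apply: (@le_trans _ _ (layer_sum (P i) g dlt N + e%:E)%E); last exact: leeD2r.
rewrite /layer_sum !big_mkord.
apply: (@le_trans _ _
    (\sum_(k < N) (dlt%:E * P i (B k) + (dlt * eta)%:E))%E).
  apply: lee_sum => k _.
  apply: (@le_trans _ _ (dlt * x k)%:E); first by rewrite EFinM -xE.
  rewrite -leeBlDr// -EFinB -mulrBr EFinM.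
  by apply: lee_wpmul2l; [rewrite lee_fin ltW|exact: xi].
rewrite big_split/=; apply: leeD2l.
rewrite sumEFin lee_fin sumr_const card_ord -mulr_natr -mulrA.
have -> : dlt * (eta * N%:R) = (N%:R * dlt) / (N.+1%:R * dlt) * e.
  by rewrite /eta [_ * N%:R]mulrC mulrCA mulrA [e * _]mulrC mulrA.
rewrite ler_piMl ?(ltW e0)// ler_pdivrMr// mul1r ler_wpM2r ?(ltW dlt0)//.
by rewrite ler_nat.
Qed.

(** Both sides are quadratic in [c] with the same leading coefficient, so the
    difference of their linear terms is bounded on one side, hence zero. *)
Lemma mean_of_quadratic_bound (R : realType) (d : measure_display)
    (T : measurableType d) (mu : {measure set T -> \bar R}) (f : T -> R)
    (m s : R) : measurable_fun setT f -> mu setT = 1%E ->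
    (forall c : R,
       (\int[mu]_x ((f x - c) ^+ 2)%:E <= (s - 2 * c * m + c ^+ 2)%:E)%E) ->
  mu.-integrable setT (EFin \o f) /\ (m%:E = \int[mu]_x (f x)%:E)%E.
Proof.
move=> mf mu1 fb.
have m2 c : measurable_fun setT (fun x => (f x - c) ^+ 2).
  by apply: measurable_funX; exact: measurable_funB.
have i2 c : mu.-integrable setT (fun x => ((f x - c) ^+ 2)%:E).
  apply/integrableP; split; first exact/measurable_EFinP.
  apply: le_lt_trans (ltry (s - 2 * c * m + c ^+ 2)).
  apply: le_trans (fb c); rewrite le_eqVlt; apply/orP; left; apply/eqP.
  by apply: eq_integral => x _; rewrite gee0_abs// lee_fin sqr_ge0.
have icst (c : R) : mu.-integrable setT (EFin \o cst c).
  apply/integrableP; split; first exact/measurable_EFinP.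
  by rewrite (eq_integral (cst `|c%:E|%E))// integral_cst// mu1 mule1 ltry.
have i1 : mu.-integrable setT (EFin \o f).
  apply: (@le_integrable _ _ _ mu setT measurableT _
    (fun x => (1 + (f x - 0) ^+ 2)%:E)) => //.
  - exact/measurable_EFinP.
  - move=> x _ /=; rewrite lee_fin subr0 [leRHS]ger0_norm ?addr_ge0 ?sqr_ge0//.
    have := sqr_ge0 (`|f x| - 1); rewrite -(real_normK (num_real (f x))) sqrrB.
    by have := sqr_ge0 `|f x|; rewrite expr1n mulr1 -mulr_natl; lra.
  - by apply: eq_integrable (integrableD measurableT (icst 1) (i2 0)).
split => //.
pose I1 := \int[mu]_x f x; pose I2 := \int[mu]_x (f x ^+ 2).
have I2c c : I2 - 2 * c * I1 + c ^+ 2 <= s - 2 * c * m + c ^+ 2.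
  rewrite -lee_fin; apply: le_trans (fb c).
  rewrite -(fineK (integrable_fin_num measurableT (i2 c))) lee_fin.
  have i0 : mu.-integrable setT (EFin \o (fun x => f x ^+ 2)).
    by apply: eq_integrable (i2 0) => // x _ /=; rewrite subr0.
  have i1c : mu.-integrable setT (EFin \o (fun x => (- (2 * c)) * f x)).
    by apply: eq_integrable (integrableZl measurableT (- (2 * c)) i1).
  have -> : fine (\int[mu]_x ((f x - c) ^+ 2)%:E)%E =
      \int[mu]_x (f x ^+ 2 + ((- (2 * c)) * f x + c ^+ 2)).
    by apply: eq_Rintegral => x _; rewrite sqrrB -mulr_natl; lra.
  rewrite RintegralD//; last first.
    by apply: eq_integrable (integrableD _ i1c (icst (c ^+ 2))).
  rewrite RintegralD//; last exact: (icst (c ^+ 2)).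
  rewrite RintegralZl// Rintegral_cst// mu1/= -/I1 -/I2; lra.
have I1m : I1 = m.
  apply: contrapT => /eqP; rewrite -subr_eq0 => Im.
  have := I2c ((I2 - s - 1) / (2 * (I1 - m))).
  set c := _ / _.
  have cE : 2 * c * (I1 - m) = I2 - s - 1.
    by rewrite /c mulrAC mulrC divfK// mulf_neq0.
  lra.
by rewrite -I1m /I1 /Rintegral fineK// integrable_fin_num.
Qed.

(** * The law of the characters of a finitely generated subalgebra *)

Lemma pushforward_borel (R : realType) (T Y : ptopologicalType) (e : T -> Y)
    (nu : {measure set (borel T) -> \bar R}) : continuous e ->
  exists P : {measure set (borel Y) -> \bar R},
    forall B : set Y, P B = nu (e @^-1` B).
Proof.
move=> ce.
have me : measurable_fun [set: borel T] (e : borel T -> borel Y).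
  apply: (@measurability _ _ (borel T) (borel Y) setT e (@open Y)) => //.
  move=> _ [B oB <-]; rewrite setTI; apply: measurable_open.
  by apply: open_comp => // x _; exact: ce.
unshelve eexists (pushforward nu (e : borel T -> borel Y)); first exact: me.
by [].
Qed.

Section local_law.
Context {R : realType} {A : charAlgType R} {V : lmodType R}.
Variables (iota : {linear V -> A}) (L : {linear A -> R | *%R}).
Variables (Q : set A) (q : hilbSeminorm V).

(** What can be seen in [S] and [F] of being a character in [K_Q] that is
    bounded by [n * q] on [V]. *)
Definition local_char (S : {pred A}) (F : {pred V}) (n : R) (f : A -> R) :
    Prop :=
  [/\ f 1 = 1,
      forall k, {in S &, forall a b, f (k *: a + b) = k * f a + f b},
      {in S &, forall a b, f (a * b) = f a * f b},
      {in S, forall a, Q a -> 0 <= f a}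
    & {in F, forall v, `|f (iota v)| <= n * q v}].

(** Zero outside [S]. The extension is rarely a character, but it makes the
    measures on the spaces [X(S)] comparable, on the space of all functions on
    [A]. *)
Definition extend_char (S : subalgClosed A) (chi : charspace (subalg S)) :
  {ptws A -> R} := fun a => chi (insubd 0 a).

Lemma extend_char_continuous (S : subalgClosed A) :
  continuous (@extend_char S).
Proof.
move=> chi; apply: cvg_ptws => [|a]; first exact/fmap_filter/(nbhs_filter chi).
exact: hat_continuous.
Qed.

Lemma extend_char_local (S : subalgClosed A) (chi : charspace (subalg S))
    (F : {pred V}) n :
  nonneg_chars [set a : subalg S | Q (val a)] chi ->
  {in F, forall v, `|extend_char chi (iota v)| <= n * q v} ->
  local_char S F n (extend_char chi).
Proof.
move=> chiQ chiF.
have valS a : a \in S -> val (insubd (0 : subalg S) a) = a.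
  by move=> aS; rewrite insubdK.
split => //.
- rewrite /extend_char (_ : insubd 0 1 = 1 :> subalg S) ?rmorph1//.
  by apply: val_inj; rewrite valS ?rpred1// rmorph1.
- move=> k a b aS bS; rewrite /extend_char.
  rewrite (_ : insubd 0 (k *: a + b) =
      k *: insubd 0 a + insubd 0 b :> subalg S).
    by rewrite rmorphD/= linearZ.
  apply: val_inj; rewrite valS ?rpredD ?rpredZ//.
  by rewrite [RHS]linearP/= !valS.
- move=> a b aS bS; rewrite /extend_char.
  rewrite (_ : insubd 0 (a * b) = insubd 0 a * insubd 0 b :> subalg S).
    by rewrite rmorphM.
  by apply: val_inj; rewrite valS ?rpredM// rmorphM/= !valS.
- by move=> a aS Qa; apply: chiQ; rewrite /= valS.
Qed.

(** This is where the trace enters. For an orthonormal family [E] adapted to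
    [F], the integral of the sum of [chi e ^ 2] over [E] is at most [tau], so
    by Markov that sum exceeds [n ^ 2] with probability at most [tau / n ^ 2];
    where it does not, Cauchy-Schwarz bounds [chi] on [F] by [n * q], because
    [chi] vanishes almost surely on the vectors of seminorm zero left over
    from the expansion. An open set of too small a probability therefore
    misses some such [chi]. *)
Lemma local_law (F : seq V) (S : subalgClosed A) (tau : R)
    (nu : {measure set (borel (charspace (subalg S))) -> \bar R}) :
    {in F, forall v, iota v \in S} -> L 1 = 1 ->
    representing_radon (fun a : subalg S => L (val a)) nu ->
    support_of nu `<=` nonneg_chars [set a : subalg S | Q (val a)] ->
    (forall E : {fset V}, hilb_orthonormal q E ->
      \sum_(e <- E) L (iota e ^+ 2) <= tau) ->
    (forall v, hform q v v = 0 -> L (iota v ^+ 2) = 0) ->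
  exists P : {measure set (borel {ptws A -> R}) -> \bar R}, [/\ P setT = 1%E,
    forall a dlt N, a \in S -> 0 < dlt ->
      (layer_sum P (fun f : {ptws A -> R} => (f a ^+ 2)%R) dlt N
        <= (L (a ^+ 2))%:E)%E
    & forall n (D : set {ptws A -> R}), 0 < n -> open D ->
      (P D < (1 - tau / n ^+ 2)%:E)%E ->
      exists2 f, ~ D f & local_char S [in F] n f].
Proof.
move=> FS L1 [nuR nuL] nuQ trE kerE.
pose sub a : subalg S := insubd 0 a.
have valS a : a \in S -> val (sub a) = a by move=> aS; rewrite insubdK.
have [P PE] := pushforward_borel nu (@extend_char_continuous S).
have nu1 : nu setT = 1%E by rewrite (representing_total nuL) rmorph1 L1.
exists P; split.
- by rewrite PE preimage_setT.
- move=> a dlt N aS dlt0.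
  rewrite (_ : layer_sum P _ dlt N = layer_sum nu (hat (sub a ^+ 2)) dlt N).
    have [/integrableP[/measurable_EFinP mb _] Lb] := nuL (sub a ^+ 2).
    rewrite -[a in leRHS]valS// -rmorphXn Lb; apply: layer_sum_le => //.
    by move=> chi; rewrite /hat rmorphXn sqr_ge0.
  apply: eq_bigr => k _; rewrite PE; congr (_ * nu _)%E.
  by apply/seteqP; split => chi; rewrite /layer /hat /= rmorphXn.
- move=> n D n0 oO PO.
  have [E [Eon Espan EF]] := gram_schmidt q F.
  have ES e : e \in E -> iota e \in S.
    apply: (Espan [set v | iota v \in S]) => /= [|k u v uS vS|//].
      by rewrite linear0 rpred0.
    by rewrite linearP rpredD ?rpredZ.
  have /choice[cz czP] : forall v, exists cz : (V -> R) * V, v \in F ->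
      v = \sum_(e <- E) cz.1 e *: e + cz.2 /\ hform q cz.2 cz.2 = 0.
    move=> v; have [vF|] := boolP (v \in F); last by exists (fun=> 0, 0).
    by have [c [z cz]] := EF v vF; exists (c, z).
  have zS v : v \in F -> iota (cz v).2 \in S.
    move=> vF; have [vE _] := czP v vF.
    have -> : (cz v).2 = v - \sum_(e <- E) (cz v).1 e *: e.
      by rewrite [v in v - _]vE addrC addKr.
    rewrite linearB -scaleN1r rpredD ?FS// rpredZ//.
    rewrite linear_sum big_seq; apply: rpred_sum => e eE.
    by rewrite linearZ rpredZ// ES.
  pose b1 := \sum_(e <- E) sub (iota e) ^+ 2.
  pose b2 := \sum_(v <- F) sub (iota (cz v).2) ^+ 2.
  have b1E (chi : charspace (subalg S)) :
      chi b1 = \sum_(e <- E) chi (sub (iota e)) ^+ 2.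
    by rewrite rmorph_sum; apply: eq_bigr => e _; rewrite rmorphXn.
  have b2E (chi : charspace (subalg S)) :
      chi b2 = \sum_(v <- F) chi (sub (iota (cz v).2)) ^+ 2.
    by rewrite rmorph_sum; apply: eq_bigr => e _; rewrite rmorphXn.
  have Lb1 : L (val b1) <= tau.
    rewrite rmorph_sum linear_sum (le_trans _ (trE E Eon))// le_eqVlt.
    apply/orP; left; apply/eqP; apply: eq_big_seq => e eE.
    by rewrite rmorphXn/= valS// ES.
  have Lb2 : L (val b2) = 0.
    rewrite rmorph_sum linear_sum big_seq big1// => v vF.
    by rewrite rmorphXn/= valS ?zS// kerE//; have [] := czP v vF.
  pose B1 := [set chi : charspace (subalg S) | n ^+ 2 < chi b1].
  pose B2 := [set chi : charspace (subalg S) | 0 < chi b2].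
  have nuB1 : (nu B1 <= (tau / n ^+ 2)%:E)%E.
    apply: le_trans (representing_markov nuL _ _) _; first exact: exprn_gt0.
      by move=> chi; rewrite b1E sumr_ge0// => e _; exact: sqr_ge0.
    by rewrite lee_fin ler_wpM2r// invr_ge0 sqr_ge0.
  have nuB2 : nu B2 = 0%E.
    apply: (representing_null nuL) => // chi.
    by rewrite b2E sumr_ge0// => e _; exact: sqr_ge0.
  have nuB3 : nu (~` support_of nu) = 0%E by exact: radon_support_null.
  apply: contrapT => nD.
  have cover : setT `<=`
      (@extend_char S @^-1` D) `|` B1 `|` B2 `|` ~` support_of nu.
    move=> chi _; apply: contrapT.
    move=> /not_orP[/not_orP[/not_orP[nDchi nB1] nB2]] /contrapT /nuQ chiQ.
    apply: nD; exists (extend_char chi) => //.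
    apply: extend_char_local => // v vF.
    have [vE z0] := czP v vF.
    have chi1 : \sum_(e <- E) chi (sub (iota e)) ^+ 2 <= n ^+ 2.
      by rewrite -b1E leNgt; apply/negP.
    have chi2 : chi (sub (iota (cz v).2)) = 0.
      have : chi b2 <= 0 by rewrite leNgt; apply/negP.
      rewrite b2E => b20.
      have /eqP : \sum_(v <- F) chi (sub (iota (cz v).2)) ^+ 2 = 0.
        apply/le_anti; rewrite b20 sumr_ge0// => u _; exact: sqr_ge0.
      rewrite psumr_eq0; last by move=> u _; exact: sqr_ge0.
      by move=> /allP/(_ v vF)/=; rewrite sqrf_eq0 => /eqP.
    have -> : extend_char chi (iota v) =
        \sum_(e <- E) (cz v).1 e * chi (sub (iota e)).
      rewrite /extend_char.
      have -> : insubd 0 (iota v) = \sum_(e <- E) (cz v).1 e *: sub (iota e)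
          + sub (iota (cz v).2).
        apply: val_inj; rewrite (valS _ (FS _ vF)) rmorphD rmorph_sum/=.
        rewrite (valS _ (zS _ vF)) {1}vE linearD linear_sum; congr (_ + _).
        by apply: eq_big_seq => e eE; rewrite !linearZ/= valS// ES.
      rewrite rmorphD/= chi2 addr0 rmorph_sum; apply: eq_bigr => e _.
      by rewrite /= linearZ.
    rewrite [v in q v]vE.
    exact: (le_hnorm_orthonormal _ Eon z0 n0 chi1).
  have mO : measurable (@extend_char S @^-1` D : set (borel _)).
    apply: measurable_open; apply: open_comp => // chi _.
    exact: extend_char_continuous.
  have mB1 : measurable (B1 : set (borel _)).
    by apply: measurable_open; exact: open_lt_hat.
  have mB2 : measurable (B2 : set (borel _)).
    by apply: measurable_open; exact: open_lt_hat.
  have mB3 : measurable (~` support_of nu : set (borel _)).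
    by apply: measurable_open; apply: closed_openC; exact: closed_support.
  suff : (nu setT < 1)%E by rewrite nu1 ltxx.
  apply: le_lt_trans (le_measure nu _ _ cover) _; rewrite ?inE//.
    by do 3?apply: measurableU.
  apply: le_lt_trans (measureU2 _ _ _) _ => //.
    by do 2?apply: measurableU.
  rewrite [X in (_ + X < _)%E](_ : _ = 0%E); last exact: nuB3.
  rewrite adde0.
  apply: le_lt_trans (measureU2 _ _ _) _ => //; first exact: measurableU.
  rewrite [X in (_ + X < _)%E](_ : _ = 0%E); last exact: nuB2.
  rewrite adde0.
  apply: le_lt_trans (measureU2 _ _ _) _ => //.
  apply: le_lt_trans (leeD2l _ nuB1) _.
  by rewrite -lteBrDr// -EFinB; move: PO; rewrite PE.
Qed.

End local_law.

(** * Compactness of the bounded characters *)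

Section bounded_characters.
Context {R : realType} {A : charAlgType R} {V : lmodType R}.
Variables (iota : {linear V -> A}) (gA : generated_by iota).
Variables (Q : set A) (q : hilbSeminorm V).

Definition bounded_chars (n : R) : set (charspace A) :=
  [set chi | nonneg_chars Q chi /\ forall v, `|chi (iota v)| <= n * q v].

(** In the limit every element of [A] and of [V] is seen. *)
Lemma ultra_local_char (I : Type) (U : set_system I) (S : I -> {pred A})
    (F : I -> {pred V}) (f : I -> A -> R) (n : R) : UltraFilter U ->
    (forall a, \forall i \near U, a \in S i) ->
    (forall v, \forall i \near U, v \in F i) ->
    (\forall i \near U, local_char iota Q q (S i) (F i) n (f i)) ->
  exists2 chi, bounded_chars n chi & forall a, f i a @[i --> U] --> chi a.
Proof.
move=> UU US UF Uf.
have [|k a b|a b|v|chi chif] := ultra_char (f := f) gA UU.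
- by near=> i; have [] : local_char iota Q q (S i) (F i) n (f i) by near: i.
- near=> i.
  have [_ fl _ _ _] : local_char iota Q q (S i) (F i) n (f i) by near: i.
  by apply: fl; near: i.
- near=> i.
  have [_ _ fM _ _] : local_char iota Q q (S i) (F i) n (f i) by near: i.
  by apply: fM; near: i.
- exists (n * q v); near=> i.
  have [_ _ _ _ fq] : local_char iota Q q (S i) (F i) n (f i) by near: i.
  by apply: fq; near: i.
exists chi => //; split => [a Qa|v].
  apply: (le_filter_lim (f := fun=> 0) _ _ (chif a)); first exact: cvg_cst.
  near=> i.
  have [_ _ _ fQ _] : local_char iota Q q (S i) (F i) n (f i) by near: i.
  by apply: fQ => //; near: i.
apply: (le_filter_lim (g := fun=> n * q v) _ (cvg_norm (chif (iota v)))).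
  exact: cvg_cst.
near=> i.
have [_ _ _ _ fq] : local_char iota Q q (S i) (F i) n (f i) by near: i.
by apply: fq; near: i.
Unshelve. all: by end_near. Qed.

(** Characters are local characters for all of [A] and [V], so an ultrafilter
    of bounded characters has a limit of the same kind. *)
Lemma bounded_chars_compact n : compact (bounded_chars n).
Proof.
rewrite compact_ultra => G UG GK.
have [|||chi chiK chiG] :=
  @ultra_local_char _ G (fun=> predT) (fun=> predT) (@char_fun R A) n UG.
- by move=> a; near=> chi.
- by move=> v; near=> chi.
- near=> chi; have [chiQ chiq] : bounded_chars n chi by near: chi.
  split => [|k a b _ _|a b _ _|a _ /chiQ//|v _]; rewrite /char_fun.
  + exact: rmorph1.
  + by rewrite rmorphD /= linearZ.
  + exact: rmorphM.
  + exact: chiq.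
by exists chi; split => //; apply: cvg_charspace => a; exact: chiG.
Unshelve. all: by end_near. Qed.

End bounded_characters.

(** * The representing measure *)

Lemma exists_ultra_seq (X : eqType) : exists U : set_system (seq X),
  UltraFilter U /\ forall x, \forall F \near U, x \in F.
Proof.
pose B := filter_from [set: seq X] (fun s => [set F : seq X | {subset s <= F}]).
have PB : ProperFilter B.
  apply: filter_from_proper => [|s _]; last by exists s.
  apply: filter_from_filter; first by exists [::].
  move=> s t _ _; exists (s ++ t) => // F stF.
  by split => x xs; apply: stF; rewrite mem_cat xs ?orbT.
have [U [UU BU]] := ultraFilterLemma PB.
exists U; split => // x; apply: BU; exists [:: x] => // F /= xF.
by apply: xF; rewrite inE.
Qed.

Lemma eventually_mem_subalg (R : realType) (A : charAlgType R) (V : lmodType R)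
    (iota : {linear V -> A}) (I : Type) (U : set_system I)
    (S : I -> subalgClosed A) : generated_by iota -> Filter U ->
    (forall v, \forall i \near U, iota v \in S i) ->
  forall a, \forall i \near U, a \in S i.
Proof.
move=> [D Diota DA] FU US a.
have : subalg_gen D a by rewrite DA.
apply: (smallest_sub (X := [set a | \forall i \near U, a \in S i])); last first.
  by move=> _ /Diota[v _ <-]; exact: US.
split => [|k x y|x y]; rewrite !inE /=.
- by near=> i; exact: rpred1.
- by move=> xS yS; near=> i; rewrite rpredD ?rpredZ//; near: i.
- by move=> xS yS; near=> i; rewrite rpredM//; near: i.
Unshelve. all: by end_near. Qed.

Lemma measurable_hat (R : realType) (A : charAlgType R) (a : A) :
  measurable_fun [set: borel (charspace A)] (hat a : borel (charspace A) -> R).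
Proof.
move=> mT; apply: (measurability _ (RGenOInfty.measurableE R)) => //.
move=> _ [_ [x ->] <-]; rewrite setTI; apply: measurable_open.
rewrite (_ : hat a @^-1` _ = [set chi : charspace A | x < chi a]).
  exact: open_lt_hat.
by apply/seteqP; split => chi /=; rewrite in_itv/= andbT.
Qed.

(** Apply the domination to [a - c] for all constants [c]: between measures of
    the same mass, an inequality of second moments forces the first ones to
    agree. *)
Lemma representing_of_moments (R : realType) (A : charAlgType R)
    (L : {linear A -> R | *%R})
    (mu : {measure set (borel (charspace A)) -> \bar R}) :
    L 1 = 1 -> mu setT = 1%E ->
    (forall a, \int[mu]_chi ((hat a chi) ^+ 2)%:E <= (L (a ^+ 2))%:E)%E ->
  representing L mu.
Proof.
move=> L1 mu1 muL a.
apply: (@mean_of_quadratic_bound _ _ _ mu (hat a) (L a) (L (a ^+ 2))) => //.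
  exact: measurable_hat.
move=> c; have := muL (a - c *: 1).
rewrite (_ : L ((a - c *: 1) ^+ 2) = L (a ^+ 2) - 2 * c * L a + c ^+ 2).
  apply: le_trans; rewrite le_eqVlt; apply/orP; left; apply/eqP.
  apply: eq_integral => chi _; rewrite /hat rmorphB/=.
  by rewrite [chi (c *: 1)]linearZ/= rmorph1 mulr1.
rewrite sqrrB exprZn expr1n -scalerAr mulr1.
have -> : L (a ^+ 2 - c *: a *+ 2 + c ^+ 2 *: 1) =
    L (a ^+ 2) - (c * L a) *+ 2 + c ^+ 2 * L 1.
  by rewrite linearD linearB linearMn !linearZ.
rewrite L1 -mulr_natl; lra.
Qed.

(** Otherwise there are, for a large set of indices, local characters outside
    [D]; they converge to a bounded character, which [D] contains. *)
Lemma bounded_chars_mass (R : realType) (A : charAlgType R) (V : lmodType R)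
    (iota : {linear V -> A}) (Q : set A) (q : hilbSeminorm V) (I : Type)
    (U : set_system I) (S : I -> {pred A}) (F : I -> {pred V})
    (P : I -> set {ptws A -> R} -> \bar R) (n : R) (c : \bar R)
    (D : set {ptws A -> R}) : generated_by iota -> UltraFilter U ->
    (forall a, \forall i \near U, a \in S i) ->
    (forall v, \forall i \near U, v \in F i) ->
    (forall i, (P i D < c)%E ->
      exists2 f, ~ D f & local_char iota Q q (S i) (F i) n f) ->
    open D -> @char_fun R A @` bounded_chars iota Q q n `<=` D ->
  (\forall i \near U, c <= P i D)%E.
Proof.
move=> gA UU US UF PD oD KD.
have [//|nU] := in_ultra_setVsetC [set i | (c <= P i D)%E] UU.
have /choice[f fP] : forall i, exists f : {ptws A -> R}, (P i D < c)%E ->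
    ~ D f /\ local_char iota Q q (S i) (F i) n f.
  move=> i; have [/PD[f nDf fl]|nP] := pselect (P i D < c)%E; first by exists f.
  by exists point => /nP.
have Ulocal : \forall i \near U, ~ D (f i) /\
    local_char iota Q q (S i) (F i) n (f i).
  by apply: filterS nU => i /= /negP; rewrite -ltNge; exact: fP.
have Ulocal2 : \forall i \near U, local_char iota Q q (S i) (F i) n (f i).
  by apply: filterS Ulocal => i [].
have [chi chiK fchi] := ultra_local_char gA UU US UF Ulocal2.
have fD : nbhs (char_fun chi) D.
  by apply: open_nbhs_nbhs; split => //; apply: KD; exists chi.
have fcvg : f @ U --> char_fun chi by apply: cvg_ptws.
have UfD : \forall i \near U, D (f i) := fcvg D fD.
have [i [Dfi [/(_ Dfi)]]] := filter_ex (filterI UfD Ulocal).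
by [].
Qed.

Theorem corollary2p20 (R : realType) (V : tvsType R) (hV : nuclear V)
  (A : charAlgType R) (iota : {linear V -> A}) (iota_inj : injective iota)
  (hA : generated_by iota)
  (K : set (charspace A)) (hK : closed K)
  (L : {linear A -> R | *%R}) (hL1 : L 1 = 1)
  (hLpos : forall a : A, 0 <= L (a ^+ 2))
  (Q : set A) (hQ : quadratic_module Q) (hKQ : K = nonneg_chars Q)
  (hloc : forall S : subalgClosed A, fin_gen_subalgs iota S ->
    exists nuS : {measure set (borel (charspace (subalg S))) -> \bar R},
      representing_radon (fun a : subalg S => L (val a)) nuS /\
      support_of nuS `<=` nonneg_chars [set a : subalg S | Q (val a)])
  (hcont : continuous (fun v : V => sL L (iota v)))
  (q : hilbSeminorm V) (M : set (charspace A))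
  (hM : M = [set chi | nonneg_chars Q chi /\
                       seminorm_continuous q (fun v : V => chi (iota v))])
  (hM0 : M !=set0)
  (htr : (hilb_trace (fun v : V => sL L (iota v)) q < +oo)%E) :
  exists nu : {measure set (borel (charspace A)) -> \bar R},
    representing_radon L nu /\ nu (~` M) = 0%E.
Proof.
have sL2 v : sL L (iota v) ^+ 2 = L (iota v ^+ 2) by rewrite sqr_sqrtr.
have [kerq [tau trE]] : (forall v, hform q v v = 0 -> L (iota v ^+ 2) = 0) /\
    exists tau : R, forall E : {fset V}, hilb_orthonormal q E ->
      \sum_(e <- E) L (iota e ^+ 2) <= tau.
  move: htr; rewrite /hilb_trace; case: asboolP => // kerq trfin.
  split => [v qv0|].
    by rewrite -sL2 (kerq v) ?expr0n//= /seminorm_ker /= /hnorm qv0 sqrtr0.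
  set s := ereal_sup _ in trfin.
  have sE (E : {fset V}) : hilb_orthonormal q E ->
      ((\sum_(e <- E) L (iota e ^+ 2))%:E <= s)%E.
    move=> Eon; apply: ereal_sup_ubound; exists E => //.
    by congr EFin; apply: eq_bigr => e _; rewrite sL2.
  have s0 : (0 <= s)%E.
    have := sE fset0; rewrite big_seq_fset0; apply.
    by move=> e f; rewrite inE.
  exists (fine s) => E /sE; rewrite -lee_fin fineK// ge0_fin_numE//.
have tau0 : 0 <= tau.
  have := trE fset0; rewrite big_seq_fset0; apply.
  by move=> e f; rewrite inE.
have [U [UU Umem]] := exists_ultra_seq V.
have /choice[SP SPP] : forall F : seq V, exists SP : subalgClosed A *
    {measure set (borel {ptws A -> R}) -> \bar R},
    [/\ {in F, forall v, iota v \in SP.1}, SP.2 setT = 1%E,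
      forall a dlt N, a \in SP.1 -> 0 < dlt ->
        (layer_sum SP.2 (fun f : {ptws A -> R} => (f a ^+ 2)%R) dlt N
          <= (L (a ^+ 2))%:E)%E
      & forall n (D : set {ptws A -> R}), 0 < n -> open D ->
        (SP.2 D < (1 - tau / n ^+ 2)%:E)%E ->
        exists2 f, ~ D f & local_char iota Q q SP.1 [in F] n f].
  move=> F; have [S SF FS] := fin_gen_subalg iota F.
  have [nu [nuL nuQ]] := hloc S SF.
  by have [P [P1 Pa PD]] := local_law FS hL1 nuL nuQ trE kerq; exists (S, P).
pose S F := (SP F).1; pose P F := (SP F).2.
have US a : \forall F \near U, a \in S F.
  apply: eventually_mem_subalg hA _ _ a => v.
  by apply: filterS (Umem v) => F vF; have [FS _ _ _] := SPP F; exact: FS.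
have P1 F : P F setT = 1%E by have [] := SPP F.
have [mu [mur muO muC]] := ultra_prokhorov (@hausdorff_ptws R A)
  (@char_fun_continuous R A) (@char_fun_inj R A) UU P1.
have muK n : 0 < n ->
    ((1 - tau / n ^+ 2)%:E <= mu (bounded_chars iota Q q n))%E.
  move=> n0; apply: muC; first exact: bounded_chars_compact.
  move=> D oD KD.
  apply: (@bounded_chars_mass _ _ _ iota Q q _ U S (fun F => [in F]) P)
    KD => //.
  by move=> F; have [_ _ _] := SPP F; apply.
have small (e : R) : 0 < e -> exists n : nat, tau / n.+1%:R ^+ 2 <= e.
  move=> e0; exists (Num.truncn (tau / e)).
  rewrite ler_pdivrMr ?exprn_gt0// mulrC -ler_pdivrMr//.
  apply: le_trans (ltW (truncnS_gt _)) _.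
  by rewrite expr2 ler_peMl// ler1n.
have mK n : measurable (bounded_chars iota Q q n : set (borel (charspace A))).
  apply: measurable_closed; apply: compact_closed.
    exact: injective_hausdorff (@char_fun_continuous R A)
      (@char_fun_inj R A) (@hausdorff_ptws R A).
  exact: bounded_chars_compact.
have muT : mu setT = 1%E.
  apply/le_anti/andP; split.
    rewrite -(@preimage_setT _ _ (@char_fun R A)).
    apply: muO; first exact: openT.
    by near=> F; rewrite P1.
  apply/lee_addgt0Pr => e /small[n ne].
  rewrite -leeBlDr// -EFinB.
  apply: (@le_trans _ _ (mu (bounded_chars iota Q q n.+1%:R))).
    by apply: le_trans (muK _ _); rewrite ?lee_fin ?lerB.
  by apply: le_measure; rewrite ?inE.
exists mu; split.
  split => //; apply: representing_of_moments => // a.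
  apply/lee_addgt0Pr => dlt dlt0; rewrite addeC -[dlt%:E]mule1 -muT.
  apply: le_layer_sum => //.
  - by apply: measurable_funX; exact: measurable_hat.
  - by move=> chi; exact: sqr_ge0.
  - move=> N; apply: (layer_sum_ultra UU muT dlt0 _
      (@char_fun_continuous R A) muO (g := fun f : {ptws A -> R} => f a ^+ 2)).
      move=> f; apply: (@continuous_comp _ _ _ (fun f : {ptws A -> R} => f a)
        (fun x : R => x ^+ 2)); first exact: eval_ptws_continuous.
      exact: exprn_continuous.
    by near=> F; have [_ _ Pa _] := SPP F; apply: Pa => //; near: F.
have ME : M = \bigcup_n bounded_chars iota Q q n.+1%:R.
  rewrite hM; apply/seteqP; split => chi.
    move=> [chiQ [C C0 chiC]]; exists (Num.truncn C) => //; split => // v.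
    apply: le_trans (chiC v) _; rewrite ler_wpM2r ?sqrtr_ge0//.
    exact/ltW/truncnS_gt.
  by move=> [n _ [chiQ chin]]; split => //; exists n.+1%:R.
have mM : measurable (M : set (borel (charspace A))).
  by rewrite ME; exact: bigcup_measurable.
apply/le_anti; rewrite measure_ge0 andbT.
apply/lee_addgt0Pr => e /small[n ne]; rewrite add0e.
apply: (@le_trans _ _ (mu (~` bounded_chars iota Q q n.+1%:R))).
  apply: le_measure; rewrite ?inE; [exact: measurableC|exact: measurableC|].
  by apply: subsetC; rewrite ME => chi; exists n.
have muC1 B : measurable (B : set (borel (charspace A))) ->
    mu (~` B) = (1 - mu B)%E.
  move=> mB; have muy : (mu setT < +oo)%E by rewrite muT ltry.
  rewrite -setTD measureD//; rewrite setTI; congr (_ - _)%E; exact: muT.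
rewrite muC1// leeBlDr; last first.
  rewrite ge0_fin_numE//; apply: (@le_lt_trans _ _ 1%E); last exact: ltry.
  by rewrite -muT; apply: le_measure; rewrite ?inE.
apply: (@le_trans _ _ (e%:E + (1 - tau / n.+1%:R ^+ 2)%:E)%E); last first.
  by apply: leeD2l; exact: muK.
by rewrite -EFinD lee_fin addrCA lerDl subr_ge0.
Unshelve. all: by end_near. Qed.
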